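(* Instant strong detectability of finite automata can be verified in linear time: there is an algorithm that, given a finite automaton $\mathcal{S}$, decides in time linear in the size of $\mathcal{S}$ whether $\mathcal{S}$ is instantly strongly detectable.
   Context: A finite automaton is a sextuple $\mathcal{S}=(X,T,X_0,\to,\Sigma,\ell)$ with $X$ a finite set of states, $T$ a finite set of events, $X_0\subset X$ a set of initial states, $\to\subset X\times T\times X$ a transition relation, $\Sigma$ a finite set of outputs (labels), and $\ell:T\to\Sigma\cup\{\epsilon\}$ a labeling function ($\epsilon$ the empty word), extended to finite and infinite event sequences by concatenation. Write $x\xrightarrow{s}x'$ for $s\in T^+$ if there is a sequence of transitions from $x$ to $x'$ with event sequence $s$. For $\sigma\in\Sigma^*$, $\mathcal{M}(\mathcal{S},\sigma)=\{x\in X\mid \exists x_0\in X_0,\exists s\in T^+: \ell(s)=\sigma,\ x_0\xrightarrow{s}x\}$, with $X_0$ additionally included when $\sigma=\epsilon$. An infinite event sequence $t_1t_2\dots\in T^\omega$ is generated by $\mathcal{S}$ if there are states $x_0,x_1,\dots$ with $x_0\in X_0$ and $(x_i,t_{i+1},x_{i+1})\in\to$ for all $i\in\mathbb{N}$; $\mathcal{L}^\omega(\mathcal{S})$ is the set of $\sigma\in\Sigma^\omega$ that equal $\ell(t_1t_2\dots)$ for some generated $t_1t_2\dots$. $\mathcal{S}$ is instantly strongly detectable if $|\mathcal{M}(\mathcal{S},\sigma)|=1$ for every finite prefix $\sigma$ (including the empty one) of every $\sigma'\in\mathcal{L}^\omega(\mathcal{S})$. *)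

(* Defs.v *)
From mathcomp Require Import all_boot.
From mathcomp Require Import boolp.

Set Implicit Arguments.
Unset Strict Implicit.
Unset Printing Implicit Defensive.

(** * Finite automata *)

(* [label t = None] means that the event [t] is labelled by the empty word. *)
Record automaton := Automaton {
  state : finType;
  event : finType;
  initial : {set state};
  trans : {set state * event * state};
  output : finType;
  label : event -> option output }.

Section Automaton.
Variable S : automaton.

Definition labels (s : seq (event S)) : seq (output S) := pmap (@label S) s.

Fixpoint run (x : state S) (s : seq (event S)) (x' : state S) : Prop :=
  if s is t :: s' then exists2 y, (x, t, y) \in trans S & run y s' x'
  else x = x'.

Definition current_states (sigma : seq (output S)) : {set state S} :=
  [set x | `[< (sigma = [::] /\ x \in initial S) \/
               exists x0 s, [/\ x0 \in initial S, s <> [::],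
                                labels s = sigma & run x0 s x] >] ].

(* The event sequence t_1 t_2 ... is [t 0, t 1, ...]. *)
Definition generated (t : nat -> event S) : Prop :=
  exists2 x : nat -> state S, x 0 \in initial S &
    forall i, (x i, t i, x i.+1) \in trans S.

(* The words [labels (mkseq t n)] form a chain of prefixes; their limit is the
   infinite word [sigma] iff every finite prefix of [sigma] occurs in it.  In
   particular [t] has infinitely many events with a nonempty label. *)
Definition labels_omega (t : nat -> event S) (sigma : nat -> output S) : Prop :=
  forall k, exists n, labels (mkseq t n) = mkseq sigma k.

Definition omega_language (sigma : nat -> output S) : Prop :=
  exists2 t, generated t & labels_omega t sigma.

Definition instantly_strongly_detectable : Prop :=
  forall sigma, omega_language sigma ->
    forall k, #|current_states (mkseq sigma k)| = 1.

Definition automaton_size : nat :=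
  #|state S| + #|event S| + #|initial S| + #|trans S| + #|output S|.

(** An automaton is presented as a word over [nat]: the cardinalities of its
    components, the initial states, the label of each event (0 for the empty
    word, i + 1 for the output numbered i), and the transitions.  The initial
    states and the transitions are listed without repetition but in arbitrary
    order.  States, events and outputs are numbered by [enum_rank]; as the
    enumeration of a [finType] is arbitrary, so is this numbering. *)

Definition label_code (a : option (output S)) : nat :=
  if a is Some b then (enum_rank b).+1 else 0.

Definition trans_code (d : state S * event S * state S) : seq nat :=
  let: (x, t, y) := d in
  [:: nat_of_ord (enum_rank x); nat_of_ord (enum_rank t);
      nat_of_ord (enum_rank y)].

Definition encodes (w : seq nat) : Prop :=
  exists (I : seq (state S)) (D : seq (state S * event S * state S)),
    [/\ perm_eq I (enum (initial S)), perm_eq D (enum (trans S)) &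
        w = [:: #|state S|; #|event S|; #|output S|; size I; size D]
            ++ [seq nat_of_ord (enum_rank x) | x <- I]
            ++ [seq label_code (label t) | t <- enum (event S)]
            ++ flatten [seq trans_code d | d <- D] ].

End Automaton.

(** * Random access machine programs *)

(** Programs work on registers and on arrays of natural numbers, both named by
    naturals; a program mentions finitely many of them.  Registers and array
    cells are accessed in unit time, and array indices may be computed (indirect
    addressing).  The only arithmetic is successor and predecessor, so that
    after t steps every stored number is at most t plus the largest number in
    the input and in the program text: the unit-cost measure hides no
    computation on large numbers. *)

Inductive test :=
| RegEq (x y : nat)
| RegLt (x y : nat).

Inductive prog :=
| Skip
| Const (x n : nat)           (* x := n *)
| Copy (x y : nat)            (* x := y *)
| Succ (x y : nat)            (* x := y + 1 *)
| Pred (x y : nat)            (* x := y - 1, truncated *)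
| Read (x a y : nat)          (* x := a[y] *)
| Write (a x y : nat)         (* a[x] := y *)
| Seq (p q : prog)
| If (b : test) (p q : prog)
| While (b : test) (p : prog).

Record memory := Memory {
  reg : nat -> nat;
  arr : nat -> nat -> nat }.

Definition upd (A : Type) (f : nat -> A) (x : nat) (v : A) : nat -> A :=
  fun y => if y == x then v else f y.

Definition set_reg (m : memory) (x v : nat) : memory :=
  Memory (upd (reg m) x v) (arr m).

Definition set_arr (m : memory) (a i v : nat) : memory :=
  Memory (reg m) (upd (arr m) a (upd (arr m a) i v)).

Definition holds (m : memory) (b : test) : bool :=
  match b with
  | RegEq x y => reg m x == reg m y
  | RegLt x y => reg m x < reg m y
  end.

(* [exec p m k m']: started in [m], [p] halts in [m'] after exactly [k] steps,
   a step being an elementary instruction or the evaluation of a test. *)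
Inductive exec : prog -> memory -> nat -> memory -> Prop :=
| exec_Skip m : exec Skip m 1 m
| exec_Const m x n : exec (Const x n) m 1 (set_reg m x n)
| exec_Copy m x y : exec (Copy x y) m 1 (set_reg m x (reg m y))
| exec_Succ m x y : exec (Succ x y) m 1 (set_reg m x (reg m y).+1)
| exec_Pred m x y : exec (Pred x y) m 1 (set_reg m x (reg m y).-1)
| exec_Read m x a y : exec (Read x a y) m 1 (set_reg m x (arr m a (reg m y)))
| exec_Write m a x y :
    exec (Write a x y) m 1 (set_arr m a (reg m x) (reg m y))
| exec_Seq p q m k1 m1 k2 m2 :
    exec p m k1 m1 -> exec q m1 k2 m2 -> exec (Seq p q) m (k1 + k2) m2
| exec_If b p q m k m' :
    exec (if holds m b then p else q) m k m' -> exec (If b p q) m k.+1 m'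
| exec_While_stop b p m : ~~ holds m b -> exec (While b p) m 1 m
| exec_While_loop b p m k1 m1 k2 m2 :
    holds m b -> exec p m k1 m1 -> exec (While b p) m1 k2 m2 ->
    exec (While b p) m (k1 + k2).+1 m2.

Lemma exec_det p m k1 m1 k2 m2 :
  exec p m k1 m1 -> exec p m k2 m2 -> k1 = k2 /\ m1 = m2.
Proof.
move=> e; elim: e k2 m2 => {p m k1 m1}
  [m|m x n|m x y|m x y|m x y|m x a y|m a x y|p q m k1 m1 k2 m2 _ IHp _ IHq
  |b p q m k m' _ IH|b p m Hb|b p m k1 m1 k2 m2 Hb _ IHp _ IHw] k3 m3 e;
  inversion e; subst; clear e => //.
- match goal with H : exec p _ _ _ |- _ => have [? ?] := IHp _ _ H; subst end.
  by match goal with H : exec q _ _ _ |- _ => have [-> ->] := IHq _ _ H end.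
- by match goal with H : exec _ m _ _ |- _ => have [-> ->] := IH _ _ H end.
- by match goal with H : is_true (holds m b) |- _ => rewrite H in Hb end.
- by match goal with H : is_true (~~ _) |- _ => rewrite Hb in H end.
- match goal with H : exec p _ _ _ |- _ => have [? ?] := IHp _ _ H; subst end.
  by match goal with H : exec (While _ _) _ _ m3 |- _ =>
    have [-> ->] := IHw _ _ H end.
Qed.

(* The input word is stored in array 0; everything else is initially 0. *)
Definition input_memory (w : seq nat) : memory :=
  Memory (fun=> 0) (fun a i => if a == 0 then nth 0 w i else 0).

(* The answer is read in register 0: 1 if [P] holds and 0 otherwise. *)
Definition answers_within (p : prog) (w : seq nat) (P : Prop) (bound : nat) :
    Prop :=
  exists k m, [/\ exec p (input_memory w) k m, k <= bound &
                  reg m 0 = nat_of_bool `[< P >] ].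

(* Main.v *)
(** A state is live if it starts an infinite run with infinitely many labelled
    events, i.e. if it reaches a cycle containing a labelled transition.
    Detectability fails exactly if there are two initial states one of which is
    live, or some reachable state [x] is live and has a silent transition to
    another state, or has two transitions with the same label to distinct states
    one of which is live.  Giving the initial states a common predecessor whose
    edges to them carry one fresh label turns the first case into the third, so
    one asks whether one of the "conflicting" vertices [b] found by scanning the
    reachable vertices reaches a labelled cycle.

    This is decided without computing strong components, by a nested depth-first
    search.  In the postorder of a search from all conflicting vertices, if [u]
    precedes [v], every successor [y] of [u] that reaches [v] reaches [u].  So
    restart a second search, with marks that are never reset, at the labelled
    successors of each [u] in postorder: a labelled cycle exists if and only if
    some [u] is marked once its own successors have been searched. *)
Require Import Defs.
From mathcomp Require Import all_boot.
From mathcomp Require Import boolp zify.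

Set Implicit Arguments.
Unset Strict Implicit.
Unset Printing Implicit Defensive.

(** * Programs and their cost *)

Arguments upd A f x v y /.

(** The cost [k] already spent is an argument, so postconditions bound absolute costs, and the
    bounds of consecutive pieces chain without subtraction. *)
Definition wp (p : prog) (m : memory) (k : nat) (Q : nat -> memory -> Prop) :=
  exists d m', exec p m d m' /\ Q (k + d) m'.

Lemma wp_mono p m k (Q Q' : nat -> memory -> Prop) :
  wp p m k Q -> (forall k' m', Q k' m' -> Q' k' m') -> wp p m k Q'.
Proof. by case=> d [m' [e q]] QQ'; exists d, m'; split=> //; apply: QQ'. Qed.

Lemma wp_skip m k (Q : nat -> memory -> Prop) : Q k.+1 m -> wp Skip m k Q.
Proof. by rewrite -addn1 => q; exists 1, m; split=> //; constructor. Qed.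

Lemma wp_const m k x n (Q : nat -> memory -> Prop) :
  Q k.+1 (set_reg m x n) -> wp (Const x n) m k Q.
Proof. by rewrite -addn1 => q; exists 1; eexists; split; [constructor|exact: q]. Qed.

Lemma wp_copy m k x y (Q : nat -> memory -> Prop) :
  Q k.+1 (set_reg m x (reg m y)) -> wp (Copy x y) m k Q.
Proof. by rewrite -addn1 => q; exists 1; eexists; split; [constructor|exact: q]. Qed.

Lemma wp_succ m k x y (Q : nat -> memory -> Prop) :
  Q k.+1 (set_reg m x (reg m y).+1) -> wp (Succ x y) m k Q.
Proof. by rewrite -addn1 => q; exists 1; eexists; split; [constructor|exact: q]. Qed.

Lemma wp_pred m k x y (Q : nat -> memory -> Prop) :
  Q k.+1 (set_reg m x (reg m y).-1) -> wp (Pred x y) m k Q.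
Proof. by rewrite -addn1 => q; exists 1; eexists; split; [constructor|exact: q]. Qed.

Lemma wp_read m k x a y (Q : nat -> memory -> Prop) :
  Q k.+1 (set_reg m x (arr m a (reg m y))) -> wp (Read x a y) m k Q.
Proof. by rewrite -addn1 => q; exists 1; eexists; split; [constructor|exact: q]. Qed.

Lemma wp_write m k a x y (Q : nat -> memory -> Prop) :
  Q k.+1 (set_arr m a (reg m x) (reg m y)) -> wp (Write a x y) m k Q.
Proof. by rewrite -addn1 => q; exists 1; eexists; split; [constructor|exact: q]. Qed.

Lemma wp_seq p q m k Q :
  wp p m k (fun k' m' => wp q m' k' Q) -> wp (Seq p q) m k Q.
Proof.
case=> d [m1 [e1 [d2 [m2 [e2 hQ]]]]]; exists (d + d2), m2.
by split; [apply: exec_Seq e1 e2 | rewrite addnA].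
Qed.

Lemma wp_if b p q m k Q :
  (holds m b -> wp p m k.+1 Q) -> (~~ holds m b -> wp q m k.+1 Q) ->
  wp (If b p q) m k Q.
Proof.
move=> hp hq.
have [d [m' [e hQ]]] : wp (if holds m b then p else q) m k.+1 Q.
  by case: ifPn.
by exists d.+1, m'; split; [constructor | rewrite addnS -addSn].
Qed.

(* Every iteration increases the cost, so a bound on it entails termination. *)
Lemma wp_while b p m k (B : nat) (Inv : nat -> memory -> Prop)
    (Q : nat -> memory -> Prop) :
  (forall k' m', Inv k' m' -> k' <= B) ->
  (forall k' m', Inv k' m' -> holds m' b -> wp p m' k'.+1 Inv) ->
  (forall k' m', Inv k' m' -> ~~ holds m' b -> Q k'.+1 m') ->
  Inv k m -> wp (While b p) m k Q.
Proof.
move=> hB hp hQ; have [n] := ubnP (B - k); elim: n => // n IH in k m *.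
move=> le_n inv; have [hb|hb] := boolP (holds m b); last first.
  by exists 1, m; split; [constructor | rewrite addn1; apply: hQ].
have [d [m' [e inv']]] := hp _ _ inv hb.
have [|d2 [m2 [e2 hQ2]]] := IH _ _ _ inv'.
  by have := hB _ _ inv'; have := hB _ _ inv; lia.
exists (d + d2).+1, m2; split; first exact: exec_While_loop hb e e2.
by rewrite addnS addnA -!addSn.
Qed.

Declare Scope prog_scope.
Notation "p ;; q" := (Seq p q) (at level 80, right associativity) : prog_scope.
Local Open Scope prog_scope.

Ltac wp_step := cbn beta iota delta [reg arr set_reg set_arr];
  lazymatch goal with
  | |- wp (Seq _ _) _ _ _ => apply: wp_seq
  | |- wp (Const _ _) _ _ _ => apply: wp_const
  | |- wp (Copy _ _) _ _ _ => apply: wp_copy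
  | |- wp (Succ _ _) _ _ _ => apply: wp_succ
  | |- wp (Pred _ _) _ _ _ => apply: wp_pred
  | |- wp (Read _ _ _) _ _ _ => apply: wp_read
  | |- wp (Write _ _ _) _ _ _ => apply: wp_write
  | |- wp Skip _ _ _ => apply: wp_skip
  end.
Ltac wp_steps := repeat wp_step.
Ltac wp_branch :=
  apply: wp_if; cbn beta iota delta [holds reg arr set_reg set_arr].

Lemma mkseq_updS (f : nat -> nat) n v : mkseq (upd f n v) n.+1 = rcons (mkseq f n) v.
Proof.
rewrite mkseqS /upd eqxx; congr rcons; apply: (@eq_from_nth _ 0).
  by rewrite !size_mkseq.
by move=> i; rewrite size_mkseq => lti; rewrite !nth_mkseq // ltn_eqF.
Qed.

(** * Reachability and the abstract invariant of depth-first search *)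

Definition graph := nat -> seq (nat * nat).
Definition frame := (nat * seq (nat * nat))%type.
Notation names := (map (@fst nat (seq (nat * nat)))).

Section Reach.
Variable G : graph.

(** An entry of [G x] is a pair of a label, 0 for a silent edge, and a target. *)
Definition succ (x : nat) : seq nat := map snd (G x).
Definition edge (x y : nat) := y \in succ x.
Definition reach (x y : nat) := exists2 p, path edge x p & last x p = y.

Lemma reach_refl x : reach x x. Proof. by exists [::]. Qed.

Lemma reach_edge x y : edge x y -> reach x y.
Proof. by move=> xy; exists [:: y] => //=; rewrite xy. Qed.

Lemma reach_trans x y z : reach x y -> reach y z -> reach x z.
Proof.
by case=> p pp <- [q pq <-]; exists (p ++ q); rewrite ?cat_path ?pp // last_cat.
Qed.

Lemma reach_closed (A : seq nat) x y :
  (forall u v, u \in A -> edge u v -> v \in A) -> x \in A -> reach x y -> y \in A.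
Proof.
move=> clA xA [p pp <-]; elim: p x xA pp => //= z p IH x xA /andP[xz pp].
exact: IH (clA _ _ xA xz) pp.
Qed.

(** A path cannot leave [A] without meeting [W], and [y] lies outside [A]. *)
Lemma reach_exit (A W : seq nat) x y :
  (forall u v, u \in A -> edge u v -> v \in W ++ A) ->
  x \in W ++ A -> reach x y -> y \notin A ->
  exists2 w, w \in W & reach x w.
Proof.
move=> clA xA [p pp <-]; elim: p x xA pp => [|z p IH] x /=.
  rewrite mem_cat => /orP[xW _ _|->//]; by exists x => //; apply: reach_refl.
rewrite mem_cat => /orP[xW _ _|xA]; first by exists x => //; apply: reach_refl.
move=> /andP[xz pp] yA; have [w wW zw] := IH _ (clA _ _ xA xz) pp yA.
by exists w => //; apply: reach_trans (reach_edge xz) zw.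
Qed.

(** Here [v] is any vertex not finished by the time [u] is, possibly one never visited; hence
    appending to [L] does not affect the conditions on earlier vertices. *)
Definition postorder (L : seq nat) := forall L1 u L2, L = L1 ++ u :: L2 ->
  forall v y, v \notin rcons L1 u -> edge u y -> reach y v -> reach y u.

(* [s] is the stack, topmost frame first, each vertex being paired with its
   unexplored edges; [L] lists the finished vertices. *)
Record dfs_inv (N : nat) (s : seq frame) (L : seq nat) : Prop := DfsInv {
  dfs_uniq : uniq (names s ++ L);
  dfs_lt : forall x, x \in names s ++ L -> x < N;
  dfs_done : forall u v, u \in L -> edge u v -> v \in names s ++ L;
  dfs_part : forall f, f \in s -> exists2 d, G f.1 = d ++ f.2 &
               forall e, e \in d -> e.2 \in names s ++ L;
  dfs_chain : forall s1 u s2, names s = s1 ++ u :: s2 ->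
               forall w, w \in s2 -> reach w u;
  dfs_post : postorder L }.

Lemma dfs_push N s L y : dfs_inv N s L -> y \notin names s ++ L -> y < N ->
  (forall u, u \in names s -> reach u y) ->
  dfs_inv N ((y, G y) :: s) L.
Proof.
case=> un lt dn pt ch po yV yN ry; split=> //.
- by rewrite /= yV.
- by move=> x; rewrite inE => /orP[/eqP->//|/lt].
- by move=> u v uL uv; rewrite inE (dn u) ?orbT.
- move=> f; rewrite inE => /orP[/eqP->|/pt[d -> hd]]; first by exists [::].
  by exists d => // e /hd; rewrite inE => ->; rewrite orbT.
- case=> [|z s1] u s2 /= []; first by move=> <- <- w; apply: ry.
  by move=> _; apply: ch.
Qed.

(** The prefix [s0] serves for an edge to a fresh vertex: the invariant wants the targets of scanned
    edges to be known, so the target is pushed first and the edge is dropped from the frame beneath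
    it. *)
Lemma dfs_scan N s0 u e r s L : dfs_inv N (s0 ++ (u, e :: r) :: s) L ->
  e.2 \in names (s0 ++ (u, e :: r) :: s) ++ L -> dfs_inv N (s0 ++ (u, r) :: s) L.
Proof.
have E : names (s0 ++ (u, e :: r) :: s) = names (s0 ++ (u, r) :: s).
  by rewrite !map_cat.
case; rewrite !E => un lt dn pt ch po eV; split=> // f.
rewrite mem_cat inE orbCA => /orP[/eqP->|fs].
  have [|d Gu hd] := pt (u, e :: r); first by rewrite mem_cat mem_head orbT.
  exists (rcons d e); first by rewrite cat_rcons.
  by move=> e'; rewrite mem_rcons inE => /orP[/eqP->//|/hd].
by apply: pt; rewrite mem_cat inE orbCA fs orbT.
Qed.

Lemma perm_finish u (s L : seq nat) : perm_eq (s ++ rcons L u) (u :: s ++ L).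
Proof. by rewrite -rcons_cat perm_rcons. Qed.

(** When [u] finishes, every edge out of the finished vertices ends in a finished vertex or on the
    stack. A path from a successor of [u] to an unfinished [v] therefore meets the stack, all of
    whose vertices reach [u]; this is the postorder condition for [u]. *)
Lemma dfs_pop N u s L : dfs_inv N ((u, [::]) :: s) L -> dfs_inv N s (rcons L u).
Proof.
case=> un lt dn pt ch po.
have eV x : (x \in names s ++ rcons L u) = (x \in u :: names s ++ L).
  exact/perm_mem/perm_finish.
have du v : edge u v -> v \in names s ++ rcons L u.
  move=> uv; have [|d /= Gu hd] := pt (u, [::]); first exact: mem_head.
  rewrite eV; move: uv; rewrite /edge /succ Gu cats0 => /mapP[e ed ->].
  exact: hd.
have dn' x v : x \in rcons L u -> edge x v -> v \in names s ++ rcons L u.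
  rewrite mem_rcons inE => /orP[/eqP->|xL]; first exact: du.
  by move=> xv; rewrite eV; apply: dn xv.
split=> //.
- by rewrite (perm_uniq (perm_finish _ _ _)).
- by move=> x; rewrite eV; apply: lt.
- move=> f fs; have [|d Gf hd] := pt f; first by rewrite inE fs orbT.
  by exists d => // e /hd; rewrite eV.
- by move=> s1 w s2 E; apply: (ch (u :: s1)); rewrite /= E.
move=> L1 w L2; case: (lastP L2) => [|L2' z].
  rewrite -[w :: [::]]/(rcons [::] w) -rcons_cat cats0.
  move=> /rcons_inj[<- <-] v y vL uy yv.
  have [w' w's yw'] := reach_exit dn' (du _ uy) yv vL.
  by apply: reach_trans yw' _; apply: (ch [::] u (names s)).
rewrite -rcons_cons -rcons_cat => /rcons_inj[E _]; exact: po E.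
Qed.

End Reach.

(** * The amortized cost of a search *)

Section Cost.
Variables (G : graph) (N : nat).

(** A vertex pays one unit for being finished and one for each of its edges; [unseen G N [::]] is
    thus the number of vertices plus the number of edges leaving them. *)
Definition weight (l : seq nat) := \sum_(x <- l) (size (G x)).+1.

Definition unseen (l : seq nat) := weight [seq x <- iota 0 N | x \notin l].

Lemma weight_cons x l : weight (x :: l) = (size (G x)).+1 + weight l.
Proof. by rewrite /weight big_cons. Qed.

Lemma weight_cat l1 l2 : weight (l1 ++ l2) = weight l1 + weight l2.
Proof. by rewrite /weight big_cat. Qed.

Lemma perm_weight l1 l2 : perm_eq l1 l2 -> weight l1 = weight l2.
Proof. exact: perm_big. Qed.

Lemma eq_unseen l1 l2 : l1 =i l2 -> unseen l1 = unseen l2.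
Proof. by move=> E; rewrite /unseen; under eq_filter do rewrite E. Qed.

Lemma unseen_cons x l : x < N -> x \notin l ->
  unseen l = (size (G x)).+1 + unseen (x :: l).
Proof.
move=> xN xl; rewrite -weight_cons; apply: perm_weight.
apply: uniq_perm; first by rewrite filter_uniq ?iota_uniq.
  by rewrite /= filter_uniq ?iota_uniq // mem_filter mem_head.
move=> y; rewrite inE !mem_filter inE mem_iota /= add0n.
by case: eqP => [->|] //=; rewrite xN xl.
Qed.

Lemma weight_le l : uniq l -> (forall x, x \in l -> x < N) ->
  weight l <= unseen [::].
Proof.
move=> ul lN; rewrite /unseen.
have /perm_weight <- : perm_eq (l ++ [seq x <- iota 0 N | x \notin l])
                                [seq x <- iota 0 N | x \notin [::]].
  apply: uniq_perm.
  - rewrite cat_uniq ul filter_uniq ?iota_uniq // andbT.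
    by apply/hasPn => x; rewrite mem_filter => /andP[].
  - by rewrite filter_uniq ?iota_uniq.
  move=> x; rewrite mem_cat !mem_filter mem_iota /= add0n.
  by case: (boolP (x \in l)) => //= /lN ->.
by rewrite weight_cat leq_addr.
Qed.

(** One unit for each unexplored edge and one for the pending pop. Visiting a vertex moves its
    weight from [unseen] to the stack. *)
Definition stack_weight (s : seq frame) := \sum_(f <- s) (size f.2).+1.

Lemma stack_weight_cons f s :
  stack_weight (f :: s) = (size f.2).+1 + stack_weight s.
Proof. by rewrite /stack_weight big_cons. Qed.

End Cost.

(** * Depth-first search *)

(* Register 0 holds the answer, 1 the constant 0, 2 the current phase, 3 the
   height of the stack, 4 the length of the log, 5 the argument of [visit];
   6 to 9 are scratch registers.  Array 0 is the input; 1 maps a vertex to its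
   first edge; 2, 3 and 4 map an edge to the next edge of its source, to its
   label and to its target; 5 maps a vertex to the last phase that visited it;
   6 maps a vertex to its next unexplored edge; 7 is the stack; 8 is the log of
   finished vertices.  Edges are numbered from 1. *)
Definition visit : prog :=
  Read 8 5 5 ;;
  If (RegEq 8 2) Skip
     (Write 5 5 2 ;; Read 8 1 5 ;; Write 6 5 8 ;; Write 7 3 5 ;; Succ 3 3).

Definition explore : prog :=
  Pred 9 3 ;; Read 6 7 9 ;; Read 7 6 6 ;;
  If (RegEq 7 1) (Write 8 4 6 ;; Succ 4 4 ;; Copy 3 9)
     (Read 8 2 7 ;; Write 6 6 8 ;; Read 5 4 7 ;; visit).

Definition depth_first : prog := visit ;; While (RegLt 1 3) explore.

(** A linked list starting at edge [p]. Requiring the indices to decrease guarantees that an edge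
    with a larger number can be added without touching the list. *)
Fixpoint chain (nx lb tg : nat -> nat) (p : nat) (l : seq (nat * nat)) : Prop :=
  if l is e :: l' then
    [/\ 0 < p, lb p = e.1, tg p = e.2, nx p < p & chain nx lb tg (nx p) l']
  else p = 0.

Definition edges_at m := chain (arr m 2) (arr m 3) (arr m 4).

Definition unchanged (m m' : memory) :=
  (forall r, ~~ (3 <= r <= 9) -> reg m' r = reg m r) /\
  (forall a, ~~ (5 <= a <= 8) -> arr m' a = arr m a).

Ltac by_index := by case=> [|[|[|[|[|[|[|[|[|[|?]]]]]]]]]].

Lemma unchanged_trans m1 m2 m3 :
  unchanged m1 m2 -> unchanged m2 m3 -> unchanged m1 m3.
Proof.
by case=> r12 a12 [r23 a23]; split=> x hx; [rewrite r23 ?r12 | rewrite a23 ?a12].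
Qed.

Section Dfs.
Variables (G : graph) (N ph : nat) (pre : seq nat).
Hypothesis G_lt : forall x y, edge G x y -> y < N.

(** [pre] is the log of the earlier phases and [L] that of the current one. Since no mark exceeds
    [ph], the next phase starts with every vertex unmarked. *)
Record dfs_mem (m : memory) (s : seq frame) (L : seq nat) : Prop := DfsMem {
  mem_zero : reg m 1 = 0;
  mem_phase : reg m 2 = ph;
  mem_stack : mkseq (arr m 7) (reg m 3) = rev (names s);
  mem_log : mkseq (arr m 8) (reg m 4) = pre ++ L;
  mem_seen : forall x, (arr m 5 x == ph) = (x \in names s ++ L);
  mem_seen_le : forall x, arr m 5 x <= ph;
  mem_cur : forall f, f \in s -> edges_at m (arr m 6 f.1) f.2;
  mem_graph : forall x, edges_at m (arr m 1 x) (G x) }.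

(** The factor 20 exceeds the cost of one round of [explore] with its loop test, and every round
    uses up one unit of weight. *)
Definition dfs_potential (s : seq frame) (L : seq nat) :=
  20 * (unseen G N (names s ++ L) + stack_weight s).

Lemma visit_spec m k s L y :
  dfs_mem m s L -> reg m 5 = y -> y < N ->
  wp visit m k (fun k' m' => exists2 s',
    if y \in names s ++ L then s' = s else s' = (y, G y) :: s &
    [/\ dfs_mem m' s' L, unchanged m m' &
        k' + dfs_potential s' L <= k + 7 + dfs_potential s L]).
Proof.
case=> z1 r2 st lg V Vle cu gr ry yN.
rewrite /visit; wp_steps; wp_branch.
  rewrite /= ry r2 V => yV; apply: wp_skip; exists s; first by rewrite yV.
  by split=> //; [split; by_index | lia].
rewrite /= ry r2 V => yV; wp_steps; exists ((y, G y) :: s).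
  by rewrite (negbTE yV).
split.
- split=> //=; rewrite /= ry ?r2 //.
  + by rewrite mkseq_updS st rev_cons.
  + by move=> x; rewrite inE; have [->|] := eqVneq x y; rewrite ?eqxx.
  + by move=> x; case: eqP.
  + move=> f; rewrite inE => /orP[/eqP->|fs] /=; first by rewrite eqxx; apply: gr.
    case: eqP => [E|_]; last exact: cu.
    by move: yV; rewrite mem_cat -E map_f.
- by split; by_index.
- rewrite /dfs_potential (unseen_cons G yN yV) stack_weight_cons /=; lia.
Qed.

(** Apart from a constant, a search is charged to the vertices it visits first, so the costs of
    successive searches in one phase telescope. *)
Lemma dfs_spec m k B L y :
  dfs_mem m [::] L -> dfs_inv G N [::] L -> reg m 5 = y -> y < N ->
  k + 10 + 20 * unseen G N L <= B ->
  wp depth_first m k (fun k' m' => exists L',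
    [/\ dfs_mem m' [::] (L ++ L') /\ dfs_inv G N [::] (L ++ L'),
        y \in L ++ L', forall x, x \in L' -> reach G y x, unchanged m m' &
        k' + 20 * unseen G N (L ++ L') <= B]).
Proof.
move=> mm inv ry yN kB; rewrite /depth_first; apply: wp_seq.
apply: wp_mono (visit_spec k mm ry yN) _ => k1 m1 [s hs [mm1 un1 kB1]].
(* The added 1 pays for the test that ends the loop. *)
pose Inv k m' := exists s L', [/\ dfs_mem m' s (L ++ L'),
  dfs_inv G N s (L ++ L') /\ y \in names s ++ (L ++ L'),
  forall x, x \in names s ++ L' -> reach G y x, unchanged m m' &
  k + 1 + dfs_potential s (L ++ L') <= B].
have Inv1 : Inv k1 m1.
  have kB2 : k1 + 1 + dfs_potential s L <= B.
    by move: kB1 kB; rewrite /dfs_potential /= {2}/stack_weight big_nil; lia.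
  exists s, [::]; rewrite !cats0; move: hs; case: ifPn => yL sE; subst s => //.
  split=> //.
  - by split; [apply: dfs_push | apply: mem_head].
  - by move=> x; rewrite inE => /eqP->; apply: reach_refl.
apply: (@wp_while _ _ _ _ B Inv).
- by move=> k' m' [s' [L' [_ _ _ _ ?]]]; lia.
- move=> {}k1 {}m1 {mm1 un1 kB1 s hs Inv1} [s [L' [mm1 [inv1 yV] rch un1 kB1]]].
  rewrite /holds (mem_zero mm1) => sp0.
  have [z1 r2 st lg V Vle cu gr] := mm1.
  case: s => [|[u r] s] in mm1 inv1 yV rch kB1 st V cu *.
    by move/(congr1 size): st; rewrite size_mkseq /= => sp; rewrite sp in sp0.
  have [n spE] : exists n, reg m1 3 = n.+1 by case: (reg m1 3) sp0 => // n _; exists n.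
  move: st; rewrite spE mkseqS /= rev_cons => /rcons_inj[st topE].
  have curE := cu _ (mem_head _ _); cbn [fst snd] in curE.
  rewrite /explore; wp_steps; rewrite /= spE /= topE.
  wp_branch; rewrite /= z1 => pE.
    case: r => [|e r] in mm1 inv1 yV rch kB1 V cu curE *; last first.
      by case: curE => + _ _ _ _; rewrite (eqP pE).
    wp_steps; exists s, (rcons L' u); rewrite -rcons_cat.
    have eV x : (x \in names s ++ rcons (L ++ L') u) = (x \in u :: names s ++ L ++ L').
      exact/perm_mem/perm_finish.
    split.
    - split=> //=.
      + rewrite mkseq_updS lg.
        by rewrite rcons_cat.
      + by move=> x; rewrite V eV.
      + by move=> f fs; apply: cu; rewrite inE fs orbT.
    - by split; [apply: dfs_pop | rewrite eV].
    - move=> x; rewrite (perm_mem (perm_finish _ _ _)); exact: rch.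
    - apply: unchanged_trans un1 _.
      by split; by_index.
    - move: kB1; rewrite /dfs_potential stack_weight_cons.
      by rewrite (eq_unseen G N eV) /=; lia.
  case: r => [|e r] in mm1 inv1 yV rch kB1 V cu curE *; first by rewrite curE in pE.
  have ue : edge G u e.2.
    have [d /= Gu _] := dfs_part inv1 (mem_head _ _).
    by rewrite /edge /succ Gu map_cat mem_cat /= mem_head orbT.
  have uV : u \in names ((u, e :: r) :: s) by rewrite mem_head.
  have rue w : w \in u :: names s -> reach G w e.2.
    rewrite inE => /orP[/eqP->|ws]; first exact: reach_edge.
    by apply: reach_trans (reach_edge ue); apply: (dfs_chain inv1 (s1 := [::])) ws.
  case: curE => _ lbE tgE nxE ch.
  have us : u \notin names s.
    by have := dfs_uniq inv1; rewrite /= mem_cat negb_or => /andP[/andP[]].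
  wp_steps => /=.
  set m2 := (X in wp visit X _ _).
  have un2 : unchanged m1 m2.
    by split; by_index.
  (* The memory has already advanced past the edge when [visit] starts; the abstract invariant
     follows only once the target is known to be visited or on the stack. *)
  have mm2 : dfs_mem m2 ((u, r) :: s) (L ++ L').
    split=> //=.
    + by rewrite /= spE mkseqS topE st rev_cons.
    + move=> f; rewrite inE => /orP[/eqP->|fs] /=; first by rewrite /= eqxx.
      rewrite /=; case: eqP => [E|_]; first by rewrite -E map_f in us.
      by apply: cu; rewrite inE fs orbT.
  have m25 : reg m2 5 = e.2 by [].
  apply: wp_mono (visit_spec _ mm2 m25 (G_lt ue)) _.
  move=> k3 m3 [s3 hs3 [mm3 un3 kB3]]; exists s3, L'.
  have yV3 x : x \in names ((u, e :: r) :: s) ++ (L ++ L') -> x \in names s3 ++ (L ++ L').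
    by move: hs3; case: ifP => _ -> // xV; rewrite inE; apply/orP; right.
  split=> //.
  - split; last exact: yV3.
    move: hs3; case: ifPn => eV sE; subst s3; first exact: (dfs_scan (s0 := [::])) inv1 eV.
    apply: (dfs_scan (s0 := [:: (e.2, G e.2)])); last exact: mem_head.
    exact: dfs_push inv1 eV (G_lt ue) rue.
  - move: hs3; case: ifP => _ -> // x; rewrite inE => /orP[/eqP->|/rch//].
    by apply: reach_trans (rch u (mem_head _ _)) (reach_edge ue).
  - by apply: unchanged_trans un1 (unchanged_trans un2 un3).
  - move: kB3 kB1; rewrite /dfs_potential !stack_weight_cons /=; lia.
- move=> k' m' [s' [L' [mm' [inv' yV'] rch un' kB']]]; rewrite /holds (mem_zero mm').
  rewrite -eqn0Ngt => /eqP sp0; have := mem_stack mm'; rewrite sp0 /=.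
  case: s' => [|f s'] in mm' inv' yV' rch kB' *; last by rewrite /= rev_cons; case: rev.
  move=> _; exists L'; split=> //.
  by move: kB'; rewrite /dfs_potential /stack_weight big_nil /=; lia.
- exact: Inv1.
Qed.
End Dfs.

(** * Building the adjacency lists *)

Definition edge_list := seq (nat * nat * nat).

Definition adj (E : edge_list) : graph :=
  fun x => [seq (e.1.2, e.2) | e <- E & e.1.1 == x].

(* The new edge runs from register 7 to register 5 with the label in
   register 8; register 6 counts the edges. *)
Definition add_edge : prog :=
  Succ 6 6 ;; Write 3 6 8 ;; Write 4 6 5 ;; Read 9 1 7 ;; Write 2 6 9 ;;
  Write 1 7 6.

(** The searches need an empty stack, an empty log and cleared marks. Array 9 is exempt because it
    holds the labels of the events. *)
Record build_mem (m : memory) (E : edge_list) : Prop := BuildMem {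
  build_zero : reg m 1 = 0;
  build_stack : reg m 3 = 0;
  build_log : reg m 4 = 0;
  build_size : reg m 6 = size E;
  build_bound : forall x, arr m 1 x <= size E;
  build_graph : forall x, edges_at m (arr m 1 x) (adj E x);
  build_clear : forall a, 5 <= a -> a != 9 -> forall i, arr m a i = 0 }.

Lemma chain_upd nx lb tg i u v w p l : p < i -> chain nx lb tg p l ->
  chain (upd nx i u) (upd lb i v) (upd tg i w) p l.
Proof.
elim: l p => //= e l IH p pi [p0 lbE tgE nxp ch].
by rewrite /upd ltn_eqF //; split=> //; apply: IH => //; apply: ltn_trans pi.
Qed.

Lemma build_mem_eq m m' E :
  (forall r, r \in [:: 1; 3; 4; 6] -> reg m' r = reg m r) ->
  (forall a, a != 0 -> a != 9 -> arr m' a = arr m a) ->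
  build_mem m E -> build_mem m' E.
Proof.
move=> er ea [z st lg sz bd gr cl].
split; rewrite /edges_at ?er ?ea //.
by move=> a a5 a9 i; rewrite ea ?cl //; case: a a5 a9.
Qed.

Lemma add_edge_spec m k E (Q : nat -> memory -> Prop) :
  build_mem m E ->
  (forall m', build_mem m' ((reg m 7, reg m 8, reg m 5) :: E) ->
    (forall r, ~~ (6 <= r <= 9) -> reg m' r = reg m r) ->
    arr m' 0 = arr m 0 -> arr m' 9 = arr m 9 -> Q (k + 6) m') ->
  wp add_edge m k Q.
Proof.
case=> z st lg sz bd gr cl hQ; rewrite /add_edge; wp_steps.
rewrite -[k.+2.+4]addn0 !addSnnS; apply: hQ => //.
- split=> //=.
  + by rewrite /= sz.
  + by move=> x; rewrite /= sz; case: eqP => // _; apply: leqW.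
  + move=> x; rewrite /edges_at /= sz /adj /=.
    have ch y : chain (upd (arr m 2) (size E).+1 (arr m 1 (reg m 7)))
                      (upd (arr m 3) (size E).+1 (reg m 8))
                      (upd (arr m 4) (size E).+1 (reg m 5)) (arr m 1 y) (adj E y).
      by apply: chain_upd; [rewrite ltnS | apply: gr].
    rewrite [reg m 7 == x]eq_sym; case: eqP => [->|_] /=; last exact: ch.
    by rewrite eqxx; split=> //; rewrite ltnS.
  + by move=> [|[|[|[|[|a]]]]] // a5 a9 i; apply: cl.
- by_index.
Qed.

(** Register 0 starts with the positive answer. Register 10 is the position in the input; 11, the
    number of states, doubles as the name of the root; 12 is the number of events; 13 becomes the
    fresh label; 14 and 15 count the initial states and transitions still to be read. *)
Definition read_header : prog :=
  Const 0 1 ;;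
  Const 10 0 ;; Read 11 0 10 ;; Succ 10 10 ;; Read 12 0 10 ;;
  Succ 10 10 ;; Read 13 0 10 ;; Succ 10 10 ;; Read 14 0 10 ;;
  Succ 10 10 ;; Read 15 0 10 ;; Succ 10 10 ;; Succ 13 13.

Definition read_initial : prog :=
  While (RegLt 1 14)
    (Read 5 0 10 ;; Succ 10 10 ;; Copy 7 11 ;; Copy 8 13 ;; add_edge ;;
     Pred 14 14).

Definition read_labels : prog :=
  While (RegLt 16 12)
    (Read 8 0 10 ;; Succ 10 10 ;; Write 9 16 8 ;; Succ 16 16).

Definition read_trans : prog :=
  While (RegLt 1 15)
    (Read 7 0 10 ;; Succ 10 10 ;; Read 8 0 10 ;; Succ 10 10 ;; Read 8 9 8 ;;
     Read 5 0 10 ;; Succ 10 10 ;; add_edge ;; Pred 15 15).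

Definition build : prog :=
  read_header ;; read_initial ;; read_labels ;; read_trans.

Definition input_at (m : memory) (l : seq nat) :=
  forall i, arr m 0 (reg m 10 + i) = nth 0 l i.

Lemma input_head m x l : input_at m (x :: l) -> arr m 0 (reg m 10) = x.
Proof. by move/(_ 0); rewrite addn0. Qed.

Lemma input_next m m' x l : arr m' 0 = arr m 0 -> reg m' 10 = (reg m 10).+1 ->
  input_at m (x :: l) -> input_at m' l.
Proof. by move=> aE rE inp i; rewrite aE rE addSnnS inp. Qed.

Definition word_of n e o (I labs : seq nat) (D : edge_list) : seq nat :=
  [:: n; e; o; size I; size D] ++ I ++ labs ++
  flatten [seq [:: d.1.1; d.1.2; d.2] | d <- D].

(** States are numbered below [n] and label codes are at most [o], so [n] is free for the root and
    [o.+1] for the label of its edges. The reversals arise because each new edge is put in front. *)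
Definition edges_of n o (I labs : seq nat) (D : edge_list) : edge_list :=
  rev [seq (d.1.1, nth 0 labs d.1.2, d.2) | d <- D] ++
  rev [seq (n, o.+1, x) | x <- I].

Lemma build_spec n e o (I labs : seq nat) (D : edge_list) B (Q : nat -> memory -> Prop) :
  size labs = e -> (forall d, d \in D -> d.1.2 < e) ->
  40 + 20 * (size I + e + size D) <= B ->
  (forall k m, k <= B -> build_mem m (edges_of n o I labs D) ->
    reg m 0 = 1 -> reg m 11 = n -> Q k m) ->
  wp build (input_memory (word_of n e o I labs D)) 0 Q.
Proof.
move=> se De kB hQ; rewrite /build /read_header; wp_steps.
rewrite /input_memory /=.
set m0 := (X in wp _ X _ _).
set Df := flatten [seq [:: d.1.1; d.1.2; d.2] | d <- D].
pose keep m := [/\ reg m 0 = 1, reg m 11 = n, reg m 12 = e,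
  reg m 13 = o.+1 & reg m 15 = size D].
(* The edges of the unread initial states [I2], put in front of the edges built so far, give the
   final list; the third loop uses the same device. *)
pose Inv1 k m := exists (I2 : seq nat) (E : edge_list), [/\ build_mem m E,
  keep m /\ reg m 16 = 0, reg m 14 = size I2 /\ input_at m (I2 ++ labs ++ Df),
  rev [seq (n, o.+1, x) | x <- I2] ++ E = edges_of n o I labs [::] &
  k + 20 * (size I2 + e + size D) + 3 <= B].
apply: (@wp_while _ _ _ _ B Inv1).
- by move=> k m [I2 [E [_ _ _ _ ?]]]; lia.
- move=> k m [I2 [E [bm [[a0 r11 r12 r13 r15] r16] [r14 inp] eE kB1]]].
  rewrite /holds (build_zero bm) r14.
  case: I2 => // x I2 in r14 inp eE kB1 * => _.
  wp_steps; apply: (@add_edge_spec _ _ E).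
    by apply: build_mem_eq bm => // r; rewrite !inE => /or4P[] /eqP->.
  move=> m' bm' er ea0 ea9; wp_steps.
  exists I2, ((n, o.+1, x) :: E); split.
  + move: bm'; rewrite /= r11 r13 (input_head inp).
    by apply: build_mem_eq => // r; rewrite !inE => /or4P[] /eqP->.
  + by rewrite /keep /= !er //=.
  + split; first by rewrite /= er //= r14.
    by apply: input_next inp; rewrite //= er.
  + by rewrite -eE /= rev_cons cat_rcons.
  + by move: kB1 => /=; lia.
- move=> k m [I2 [E [bm [kp r16] [r14 inp] eE kB1]]].
  rewrite /holds (build_zero bm) r14 -leqNgt leqn0 => /nilP I20.
  rewrite {}I20 in inp eE kB1 {r14}; rewrite /= in inp eE kB1.
  pose Inv2 k m := exists l : seq nat, [/\ build_mem m E, keep m,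
    [/\ size l + reg m 16 = e, input_at m (l ++ Df) &
    (forall i, i < reg m 16 -> arr m 9 i = nth 0 labs i)],
    (forall i, nth 0 l i = nth 0 labs (reg m 16 + i)) &
    k + 20 * (size l + size D) + 2 <= B].
  apply: wp_seq; apply: (@wp_while _ _ _ _ B Inv2).
  + by move=> k' m' [l [_ _ _ _ ?]]; lia.
  + move=> {kp r16 inp kB1 k bm}k {}m [l [bm [a0 r11 r12 r13 r15] [sl inp lb] ln kB1]].
    rewrite /holds r12 => lt; case: l => [|x l] in sl inp ln kB1.
      by move: sl => /=; lia.
    rewrite /read_labels; wp_steps; exists l; split.
    * apply: build_mem_eq bm => [r|]; last by_index.
      by rewrite !inE => /or4P[] /eqP->.
    * by [].
    * split; rewrite /=; first by move: sl => /=; lia.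
        exact: input_next inp.
      move=> i; rewrite ltnS leq_eqVlt => /orP[/eqP->|lti].
        by rewrite eqxx (input_head inp) -[reg m 16]addn0 -ln.
      by rewrite ltn_eqF // lb.
    * by move=> i; rewrite /= addSnnS -ln.
    * by move: kB1 => /=; lia.
  + move=> {kp r16 inp kB1 k bm}k {}m [l [bm kp [sl inp lb] ln kB1]].
    rewrite /holds; case: (kp) => _ _ -> _ _; rewrite -leqNgt => le.
    have l0 : size l = 0 by lia.
    move/size0nil: l0 => l0; rewrite {}l0 /= in sl inp kB1 {ln}.
    pose Inv3 k m := exists (D2 E : edge_list), [/\ build_mem m E,
      [/\ reg m 0 = 1, reg m 11 = n & reg m 15 = size D2],
      (forall d, d \in D2 -> arr m 9 d.1.2 = nth 0 labs d.1.2) /\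
        input_at m (flatten [seq [:: d.1.1; d.1.2; d.2] | d <- D2]),
      rev [seq (d.1.1, nth 0 labs d.1.2, d.2) | d <- D2] ++ E =
        edges_of n o I labs D &
      k + 20 * size D2 + 1 <= B].
    apply: (@wp_while _ _ _ _ B Inv3).
    * by move=> k' m' [D2 [E2 [_ _ _ _ ?]]]; lia.
    * move=> {kp sl inp lb kB1 k bm eE le}k {}m.
      move=> [D2 [E2 [bm [a0 r11 r15] [lb inp] eE kB1]]].
      rewrite /holds (build_zero bm) r15.
      case: D2 => // d D2 in r15 lb inp eE kB1 * => _.
      have inp1 : arr m 0 (reg m 10).+1 = d.1.2 by rewrite -addn1 inp.
      have inp2 : arr m 0 (reg m 10).+2 = d.2 by rewrite -addn2 inp.
      wp_steps; apply: (@add_edge_spec _ _ E2).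
        by apply: build_mem_eq bm => // r; rewrite !inE => /or4P[] /eqP->.
      move=> m' bm' er ea0 ea9; wp_steps.
      exists D2, ((d.1.1, nth 0 labs d.1.2, d.2) :: E2); split.
      - move: bm'; rewrite /= (input_head inp) inp1 inp2 (lb _ (mem_head _ _)).
        by apply: build_mem_eq => // r; rewrite !inE => /or4P[] /eqP->.
      - by rewrite /= !er //= a0 r11 r15.
      - split; first by move=> d' d'D; rewrite /= ea9 /= lb // inE d'D orbT.
        by move=> i; rewrite /= ea0 er //= -addn3 -addnA inp.
      - by rewrite -eE /= rev_cons cat_rcons.
      - by move: kB1 => /=; lia.
    * move=> {kp sl inp lb kB1 k bm eE le}k {}m.
      move=> [D2 [E2 [bm [a0 r11 r15] [lb inp] eE kB1]]].
      rewrite /holds (build_zero bm) r15 -leqNgt leqn0 => /nilP D20.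
      apply: hQ => //; first by lia.
      by rewrite -eE D20.
    * exists D, E; split=> //.
      - by case: kp.
      - by split=> // d /De; rewrite -sl; apply: lb.
      - by rewrite eE /edges_of.
      - by lia.
  + exists labs; split=> //; last by rewrite se; lia.
    * by rewrite r16 addn0.
    * by move=> i; rewrite r16.
- exists I, [::]; split=> //; last by lia.
  - by split=> //; case.
  - by rewrite cats0.
Qed.

(** * Conflicts and labelled cycles *)

Definition find_reachable : prog := Const 2 1 ;; Copy 5 11 ;; depth_first.

(* [arr 10 a] is the last position of the log whose vertex has a scanned edge
   labelled [a], counted from 1, and [arr 11 a] the target of the first such
   edge. *)
Definition scan_edge : prog :=
  Read 14 3 13 ;; Read 15 4 13 ;; Read 13 2 13 ;;
  If (RegEq 14 1)
    (If (RegEq 15 12) Skip (Copy 5 12 ;; depth_first))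
    (Read 16 10 14 ;;
     If (RegEq 16 10)
       (Read 16 11 14 ;;
        If (RegEq 16 15) Skip (Copy 5 16 ;; depth_first ;; Copy 5 15 ;; depth_first))
       (Write 10 14 10 ;; Write 11 14 15)).

(** The searches extend the log while it is being scanned; register 17 freezes the length it had
    after the first phase. *)
Definition find_conflicts : prog :=
  Const 2 2 ;; Copy 17 4 ;; Const 10 0 ;;
  While (RegLt 10 17)
    (Read 12 8 10 ;; Read 13 1 12 ;; Succ 10 10 ;;
     While (RegLt 1 13) scan_edge).

Definition follow_edge : prog :=
  Read 14 3 13 ;; Read 15 4 13 ;; Read 13 2 13 ;;
  If (RegEq 14 1) Skip (Copy 5 15 ;; depth_first).

(** Register 10 is not reset, so exactly the vertices logged in the second phase are treated, in
    postorder. *)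
Definition find_cycles : prog :=
  Const 2 3 ;; Copy 17 4 ;;
  While (RegLt 10 17)
    (Read 12 8 10 ;; Read 13 1 12 ;; Succ 10 10 ;;
     While (RegLt 1 13) follow_edge ;;
     Read 16 5 12 ;; If (RegEq 16 2) (Const 0 0) Skip).

Lemma mkseq_split (f : nat -> nat) n l1 x l2 :
  mkseq f n = l1 ++ x :: l2 -> f (size l1) = x.
Proof.
move=> E; have sz : size l1 < n.
  by rewrite -(size_mkseq f n) E size_cat /= addnS ltnS leq_addr.
by rewrite -[LHS](nth_mkseq 0 f sz) E nth_cat ltnn subnn.
Qed.

Section Criterion.
Variable G : graph.

(** [b] is the vertex whose liveness turns the situation at [x] into a violation. In the silent case
    liveness of [y] would imply that of [x], so [x] covers both. *)
Definition conflict (x b : nat) :=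
  (b = x /\ exists2 y, (0, y) \in G x & y != x) \/
  (exists a y, [/\ a != 0, (a, b) \in G x, (a, y) \in G x & y != b]).

Definition on_labelled_cycle (u : nat) :=
  exists a y, [/\ a != 0, (a, y) \in G u & reach G y u].

Definition rejected (root : nat) := exists x b u,
  [/\ reach G root x, conflict x b, reach G b u & on_labelled_cycle u].

Lemma edge_mem a x y : (a, y) \in G x -> edge G x y.
Proof. exact: (map_f snd). Qed.

Definition labelled_targets (l : seq (nat * nat)) :=
  [seq e.2 | e <- l & e.1 != 0].

Lemma labelled_targetsP l y :
  reflect (exists2 a, a != 0 & (a, y) \in l) (y \in labelled_targets l).
Proof.
apply: (iffP mapP) => [[[a z] /=]|[a a0 ay]].
  by rewrite mem_filter => /andP[a0 az] ->; exists a.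
by exists (a, y); rewrite // mem_filter a0.
Qed.

End Criterion.

Section Phases.
Variables (G : graph) (N : nat).
Hypothesis G_lt : forall x y, edge G x y -> y < N.

Definition dfs_state ph pre m L := dfs_mem G ph pre m [::] L /\ dfs_inv G N [::] L.

Lemma dfs_state_eq ph pre m m' L :
  (forall r, 1 <= r <= 4 -> reg m' r = reg m r) ->
  (forall a, 1 <= a <= 8 -> arr m' a = arr m a) ->
  dfs_state ph pre m L -> dfs_state ph pre m' L.
Proof.
move=> er ea [[z r2 st lg V Vle cu gr] inv]; split=> //.
by split; rewrite /edges_at ?er ?ea.
Qed.

(** Raising the phase number invalidates all marks at once, and the old log becomes the prefix of
    the new one. *)
Lemma dfs_state_next ph ph' pre m m' L : ph < ph' ->
  reg m' 2 = ph' -> (forall r, r \in [:: 1; 3; 4] -> reg m' r = reg m r) ->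
  (forall a, 1 <= a <= 8 -> arr m' a = arr m a) ->
  dfs_state ph pre m L -> dfs_state ph' (pre ++ L) m' [::].
Proof.
move=> lt r2' er ea [[z r2 st lg V Vle cu gr] inv]; split.
  split; rewrite ?cats0 /edges_at ?ea ?(er 1) ?(er 3) ?(er 4) //.
  - by move=> x; rewrite ltn_eqF // (leq_ltn_trans (Vle x)).
  - by move=> x; rewrite ltnW // (leq_ltn_trans (Vle x)).
by split=> // L1 u L2; case: L1.
Qed.

Lemma dfs_call ph pre m k L (Q : nat -> memory -> Prop) :
  dfs_state ph pre m L -> reg m 5 < N ->
  (forall k' m' L', dfs_state ph pre m' (L ++ L') ->
    reg m 5 \in L ++ L' -> (forall x, x \in L' -> reach G (reg m 5) x) ->
    unchanged m m' ->
    k' + 20 * unseen G N (L ++ L') <= k + 10 + 20 * unseen G N L -> Q k' m') ->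
  wp depth_first m k Q.
Proof.
move=> [mm inv] yN hQ.
apply: wp_mono (@dfs_spec _ _ _ _ G_lt _ k _ _ _ mm inv erefl yN (leqnn _)) _.
by move=> k' m' [L' [st' yL' rch un kB]]; apply: hQ kB.
Qed.

Lemma log_read ph pre m L l1 x l2 : dfs_state ph pre m L ->
  pre ++ L = l1 ++ x :: l2 -> arr m 8 (size l1) = x.
Proof. case=> -[_ _ _ lg _ _ _ _] _ E.
by apply: (@mkseq_split _ (reg m 4) _ _ l2); rewrite lg E. Qed.

Lemma log_size ph pre m L : dfs_state ph pre m L -> reg m 4 = size (pre ++ L).
Proof. by case=> -[_ _ _ lg _ _ _ _] _; rewrite -lg size_mkseq. Qed.

Lemma state_graph ph pre m L : dfs_state ph pre m L ->
  forall x, edges_at m (arr m 1 x) (G x).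
Proof. by case=> -[]. Qed.

Lemma state_zero ph pre m L : dfs_state ph pre m L -> reg m 1 = 0.
Proof. by case=> -[]. Qed.

(** * Second phase: searching from the conflicting vertices *)

Section Conflicts.
Variables (root : nat) (L1 : seq nat).
Hypothesis L1_lt : forall x, x \in L1 -> x < N.
Hypothesis L1_reach : forall x, x \in L1 -> reach G root x.

Definition bad (v : nat) :=
  exists x b, [/\ reach G root x, conflict G x b & reach G b v].

(** The scanned edges [d] of [x] have been dealt with. An entry of array 10 below [i] stems from an
    earlier vertex and counts as empty, so the table is never cleared. *)
Definition table (m : memory) (i x : nat) (d : seq (nat * nat)) (L : seq nat) :=
  [/\ forall y, (0, y) \in d -> y != x -> x \in L,
      forall a, arr m 10 a <= i,
      forall a y, (a, y) \in d -> a != 0 -> arr m 10 a = i /\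
        (y = arr m 11 a \/ y \in L /\ arr m 11 a \in L) &
      forall a, arr m 10 a = i -> a != 0 /\ (a, arr m 11 a) \in d].

(** Comparing each target with the first one of its label suffices. If [b] is not that first target,
    it was searched when compared with it; if it is, the distinct target [y] caused the search from
    both. *)
Lemma table_conflict m i x L b : table m i x (G x) L -> conflict G x b -> b \in L.
Proof.
case=> eps _ tab _ [[-> [y xy yx]]|[a [y [a0 ab ay yb]]]]; first exact: eps yx.
have [_ [->|[]]//] := tab _ _ ab a0.
have [_ [yE|[]]] := tab _ _ ay a0; last by [].
have [_ [bE|[]]//] := tab _ _ ab a0; by rewrite yE bE eqxx in yb.
Qed.

Record scan_inv (i x : nat) (m : memory) (d : seq (nat * nat)) (L : seq nat) :
    Prop := ScanInv {
  scan_state : dfs_state 2 L1 m L;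
  scan_regs : [/\ reg m 0 = 1, reg m 10 = i, reg m 12 = x & reg m 17 = size L1];
  scan_table : table m i x d L;
  scan_bad : forall v, v \in L -> bad v }.


Lemma table_mono m m' i x d L L' : arr m' 10 = arr m 10 -> arr m' 11 = arr m 11 ->
  {subset L <= L'} -> table m i x d L -> table m' i x d L'.
Proof.
move=> e10 e11 sub [eps le tab own]; split; rewrite ?e10 ?e11 //.
  by move=> y yd yx; apply: sub; apply: eps yx.
move=> a y ad a0; have [-> h] := tab _ _ ad a0; split=> //.
by case: h => [|[/sub yL /sub fL]]; [left | right].
Qed.

Lemma table_eps m i x d y L : table m i x d L -> (y != x -> x \in L) ->
  table m i x (rcons d (0, y)) L.
Proof.
case=> eps le tab own yx; split=> //.
- by move=> z; rewrite mem_rcons inE => /orP[/eqP[->]|/eps].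
- move=> a z; rewrite mem_rcons inE => /orP[/eqP[->]//|]; exact: tab.
- by move=> a /own[a0 ad]; rewrite mem_rcons inE ad orbT.
Qed.

Lemma table_old m i x d a y L : table m i x d L -> a != 0 -> arr m 10 a = i ->
  y = arr m 11 a \/ y \in L /\ arr m 11 a \in L -> table m i x (rcons d (a, y)) L.
Proof.
case=> eps le tab own a0 ai ya; split=> //.
- move=> z; rewrite mem_rcons inE => /orP[/eqP[aE]|]; last exact: eps.
  by rewrite -aE in a0.
- move=> b z; rewrite mem_rcons inE => /orP[/eqP[-> ->]//|]; exact: tab.
- by move=> b /own[b0 bd]; rewrite mem_rcons inE bd orbT.
Qed.

Lemma table_new m m' i x d a y L : table m i x d L -> a != 0 -> arr m 10 a != i ->
  arr m' 10 = upd (arr m 10) a i -> arr m' 11 = upd (arr m 11) a y ->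
  table m' i x (rcons d (a, y)) L.
Proof.
case=> eps le tab own a0 ai e10 e11.
have ad z : (a, z) \notin d.
  by apply/negP => /tab/(_ a0)[E _]; rewrite E eqxx in ai.
split; rewrite ?e10 ?e11 /upd.
- move=> z; rewrite mem_rcons inE => /orP[/eqP[aE]|]; last exact: eps.
  by rewrite -aE in a0.
- by move=> b; case: eqP.
- move=> b z; rewrite mem_rcons inE => /orP[/eqP[-> ->] _|bd b0].
    by rewrite eqxx; split=> //; left.
  case: eqP => [bE|_]; last exact: tab.
  by rewrite bE (negbTE (ad z)) in bd.
- move=> b; rewrite mem_rcons inE; case: eqP => [-> _|_ /own[b0 bd]].
    by rewrite eqxx.
  by rewrite bd orbT.
Qed.

Lemma bad_cat x y L L' : reach G root x -> conflict G x y ->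
  (forall v, v \in L -> bad v) -> (forall v, v \in L' -> reach G y v) ->
  forall v, v \in L ++ L' -> bad v.
Proof.
move=> rx cf bL bL' v; rewrite mem_cat => /orP[/bL//|/bL' yv].
by exists x, y.
Qed.

(** The vertices newly visited pay for the searches, which leaves a constant for the edge itself:
    39, or 40 with the loop test. *)
Lemma scan_edge_spec i x m k d e r L :
  scan_inv i x m d L -> G x = d ++ e :: r -> reach G root x -> x < N ->
  edges_at m (reg m 13) (e :: r) ->
  wp scan_edge m k (fun k' m' => exists L', [/\ scan_inv i x m' (rcons d e) (L ++ L'),
    edges_at m' (reg m' 13) r &
    k' + 20 * unseen G N (L ++ L') <= k + 39 + 20 * unseen G N L]).
Proof.
move=> [st [r0 r10 r12 r17] tab bd] Gx rx xN [p0 lbE tgE _ ch].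
have z1 : reg m 1 = 0 by case: st => -[].
case: e => a y /= in Gx lbE tgE *.
have xy : (a, y) \in G x by rewrite Gx mem_cat mem_head orbT.
have sub z : z \in d -> z \in G x by rewrite Gx mem_cat => ->.
have yN : y < N by apply: G_lt (edge_mem xy).
rewrite /scan_edge; wp_steps; rewrite /= lbE tgE.
wp_branch; rewrite /= z1.
  move=> /eqP a0; rewrite {}a0 in xy Gx lbE *.
  wp_branch; rewrite /= r12.
    move=> /eqP yx; wp_steps; exists [::]; rewrite cats0; split=> //; last by lia.
    split=> //; first by apply: dfs_state_eq st; by_index.
    by apply: table_eps; rewrite ?yx ?eqxx // -yx.
  move=> yx; wp_steps; rewrite /= r12.
  have cf : conflict G x x by left; split=> //; exists y.
  apply: dfs_call => [||k' m' L' st' xL rch [er ea] kB].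
  - by apply: dfs_state_eq st; by_index.
  - by [].
  exists L'; rewrite /= in xL rch kB; split=> //; last by lia.
    split=> //.
    + by rewrite !er.
    + apply: table_eps => //.
      apply: table_mono tab; rewrite ?ea //.
      by move=> z zL; rewrite mem_cat zL.
    + exact: bad_cat rx cf bd rch.
  by rewrite /edges_at !ea // er.
move=> a0; wp_steps; rewrite /=.
wp_branch; rewrite /= r10; last first.
  move=> ai; wp_steps; exists [::]; rewrite cats0; split=> //; last by lia.
  split=> //; first by apply: dfs_state_eq st; by_index.
  by apply: table_new tab a0 ai _ _; rewrite /= ?r10.
move=> /eqP ai; wp_steps; rewrite /=.
wp_branch; rewrite /=.
  move=> /eqP fy; wp_steps; exists [::]; rewrite cats0; split=> //; last by lia.
  split=> //; first by apply: dfs_state_eq st; by_index.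
  by apply: table_old => //; left.
move=> fy; wp_steps; rewrite /=.
(* As array 10 contains the current position, the entry of array 11 is the target of an edge of [x]
   labelled [a]. *)
have [_ _ _ /(_ _ ai)[_ fd]] := tab.
have cf1 : conflict G x (arr m 11 a).
  by right; exists a, y; split=> //; [apply: sub | rewrite eq_sym].
have cf2 : conflict G x y by right; exists a, (arr m 11 a); split=> //; apply: sub.
apply: dfs_call => [||k1 m1 La st1 fL rch1 [er1 ea1] kB1].
- by apply: dfs_state_eq st; by_index.
- by rewrite /=; apply: G_lt (edge_mem (sub _ fd)).
rewrite /= in fL rch1 kB1; wp_steps.
apply: dfs_call => [||k2 m2 Lb st2 yL rch2 [er2 ea2] kB2].
- by apply: dfs_state_eq st1; by_index.
- by rewrite /= er1 //= /upd.
rewrite /= er1 //= in yL rch2; rewrite -catA in st2 yL kB2.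
exists (La ++ Lb); split; last by rewrite /= in kB2; lia.
  split=> //.
  + by rewrite !er2 //= !er1.
  + apply: table_old => //; last 1 first.
    * right; split=> //; rewrite ea2 //= ea1 //= catA mem_cat.
      by rewrite /= in fL *; rewrite fL.
    * apply: table_mono tab; rewrite ?ea2 //= ?ea1 //.
      by move=> z zL; rewrite mem_cat zL.
    * by rewrite ea2 //= ea1.
  + by rewrite catA; apply: (bad_cat rx cf2 _ rch2); apply: (bad_cat rx cf1 bd rch1).
by rewrite /edges_at !ea2 //= !ea1 // er2 //= er1.
Qed.

Lemma find_conflicts_spec m k :
  dfs_state 1 [::] m L1 -> reg m 0 = 1 -> (forall a, arr m 10 a = 0) ->
  wp find_conflicts m k (fun k' m' => exists L2,
    [/\ dfs_state 2 L1 m' L2, reg m' 0 = 1 /\ reg m' 10 = size L1,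
        forall v, v \in L2 -> bad v,
        forall x b, x \in L1 -> conflict G x b -> b \in L2 &
        k' + 20 * unseen G N L2 <=
          k + 6 + 20 * unseen G N [::] + 40 * weight G L1]).
Proof.
move=> st r0 own; rewrite /find_conflicts; wp_steps; rewrite /=.
have [B BE] : exists B, B = k + 6 + 20 * unseen G N [::] + 40 * weight G L1.
  by exists (k + 6 + 20 * unseen G N [::] + 40 * weight G L1).
rewrite -BE.
(* [l1] is the scanned part of the log, and the term with [weight G l2] prepays the scan of the
   rest. *)
pose Inv k m := exists l1 l2 L : seq nat, [/\ L1 = l1 ++ l2 /\ dfs_state 2 L1 m L,
  [/\ reg m 0 = 1, reg m 10 = size l1, reg m 17 = size L1 &
      forall a, arr m 10 a <= size l1],
  forall v, v \in L -> bad v,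
  forall x b, x \in l1 -> conflict G x b -> b \in L &
  k + 3 + 20 * unseen G N L + 40 * weight G l2 <= B].
apply: (@wp_while _ _ _ _ B Inv).
- by move=> k' m' [l1 [l2 [L [_ _ _ _ ?]]]]; lia.
- move=> {BE}k {st r0 own}m [l1 [l2 [L [[LE st] [r0 r10 r17 own] bd cov kB]]]].
  rewrite /holds r10 r17 LE size_cat.
  case: l2 => [|x l2] in LE kB *; first by rewrite addn0 ltnn.
  move=> _; wp_steps; rewrite /=.
  have xL : x \in L1 by rewrite LE mem_cat mem_head orbT.
  rewrite r10 (@log_read _ _ _ _ l1 x (l2 ++ L) st); last by rewrite LE -catA.
  set i := (size l1).+1.
  pose Inv2 k m := exists (d r : seq (nat * nat)) (L' : seq nat),
    [/\ scan_inv i x m d (L ++ L'), G x = d ++ r, edges_at m (reg m 13) r &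
    k + 2 + 20 * unseen G N (L ++ L') + 40 * (size r + weight G l2) + 2 <= B].
  apply: (@wp_while _ _ _ _ B Inv2).
  + by move=> k' m' [d [r [L' [_ _ _ ?]]]]; lia.
  + move=> k' m' [d [r [L' [sc Gx ch kB']]]].
    rewrite /holds (state_zero (scan_state sc)).
    case: r => [|e r] in Gx ch kB' *; first by rewrite ch.
    move=> _; apply: wp_mono (scan_edge_spec _ sc Gx (L1_reach xL) (L1_lt xL) ch) _.
    move=> k2 m2 [La [sc2 ch2 kB2]]; exists (rcons d e), r, (L' ++ La).
    by rewrite catA cat_rcons; split=> //; move: kB' => /=; lia.
  + move=> k' m' [d [r [L' [sc Gx ch kB']]]].
    have [st' [r0' r10' _ r17'] tab bd'] := sc.
    rewrite /holds (state_zero st'); case: r => [|e r] in Gx ch kB' *; last first.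
      by case: ch => ->.
    move=> _; rewrite cats0 in Gx; rewrite -Gx in tab.
    exists (rcons l1 x), l2, (L ++ L'); split.
    * by rewrite cat_rcons.
    * by rewrite size_rcons; split=> //; case: tab.
    * by [].
    * move=> z b; rewrite mem_rcons inE => /orP[/eqP->|zl] cf.
        exact: table_conflict tab cf.
      by rewrite mem_cat (cov _ _ zl cf).
    * by move: kB' => /=; lia.
  + exists [::], (G x), [::]; rewrite cats0; split=> //.
    * split=> //; first by apply: dfs_state_eq st; by_index.
      (* Earlier vertices left entries of at most [size l1], all different from the new position
         [(size l1).+1]. *)
      by split=> // a; rewrite /= ?leqW // => E; have := own a; rewrite E ltnn.
    * exact: state_graph st _.
    * by move: kB; rewrite weight_cons; lia.
- move=> {BE}k {st r0 own}m [l1 [l2 [L [[LE st] [r0 r10 r17 own] bd cov kB]]]].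
  case: l2 => [|x l2] in LE kB *; last first.
    by rewrite /holds r10 r17 LE size_cat /= addnS ltnS leq_addr.
  move=> _; rewrite cats0 in LE; rewrite -LE in cov r10.
  by exists L; split=> //; lia.
- exists [::], L1, [::]; split=> //=.
  + by split=> //; apply: dfs_state_next st => //; by_index.
  + by rewrite (log_size st); split=> // a; rewrite own.
  + by rewrite BE; lia.
Qed.

End Conflicts.

(** * Third phase: detecting a labelled cycle *)

Section Cycles.
Variables L1 L2 : seq nat.
Hypothesis L2_inv : dfs_inv G N [::] L2.

Definition exits (l : seq nat) (d : seq (nat * nat)) (y : nat) :=
  (exists2 u, u \in l & y \in labelled_targets (G u)) \/ y \in labelled_targets d.

Lemma exits_rcons l d e y : exits l (rcons d e) y ->
  exits l d y \/ e.1 != 0 /\ y = e.2.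
Proof.
case=> [|/labelled_targetsP[a a0]]; first by left; left.
rewrite mem_rcons inE => /orP[/eqP<-|ad]; first by right.
by left; right; apply/labelled_targetsP; exists a.
Qed.

Lemma exits_next l x y : exits (rcons l x) [::] y -> exits l (G x) y.
Proof.
case=> [[u]|] //; rewrite mem_rcons inE => /orP[/eqP->|ul] yu; first by right.
by left; exists u.
Qed.

Lemma exits_step l x y : exits l (G x) y -> exits (rcons l x) [::] y.
Proof.
case=> [[u ul]|] yu; left; last by exists x; rewrite // mem_rcons mem_head.
by exists u; rewrite // mem_rcons inE ul orbT.
Qed.

(** As [L] is closed under edges, the two inclusions make it the set of all vertices reachable from
    the labelled targets followed so far. *)
Record follow_inv (l : seq nat) (d : seq (nat * nat)) (m : memory) (L : seq nat) :
    Prop := FollowInv {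
  follow_state : dfs_state 3 (L1 ++ L2) m L;
  follow_sound : forall v, v \in L -> exists2 y, exits l d y & reach G y v;
  follow_complete : forall y, exits l d y -> y \in L }.

Definition answer (l : seq nat) : nat :=
  ~~ `[< exists2 u, u \in l & on_labelled_cycle G u >].

(* The postorder shows that a cycle through [x] entered from an earlier vertex
   [u] leads back to [u]. *)
Lemma answer_found l1 x l2 m L : L2 = l1 ++ x :: l2 -> follow_inv l1 (G x) m L ->
  x \in L -> answer (rcons l1 x) = 0.
Proof.
move=> LE [_ snd _] /snd[y yx rx].
suff H : exists2 u, u \in rcons l1 x & on_labelled_cycle G u.
  by rewrite /answer; case: asboolP.
case: yx => [[u ul]|] /labelled_targetsP[a a0 ay]; last first.
  by exists x; [rewrite mem_rcons mem_head | exists a, y].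
exists u; first by rewrite mem_rcons inE ul orbT.
exists a, y; split=> //.
case/splitPr: ul LE => p q LE.
have po := dfs_post L2_inv; have un := dfs_uniq L2_inv.
apply: (po p u (q ++ x :: l2) _ x y) => //; last exact: edge_mem ay.
  by rewrite LE -catA.
move: un; rewrite /= LE -catA cat_cons -cat_rcons cat_uniq => /and3P[_ + _].
by move=> /hasPn; apply; rewrite mem_cat mem_head orbT.
Qed.

(** The labelled targets of [x] lie in [L], which is closed under edges. A labelled cycle through
    [x] leaving by one of them would put [x] in [L]. *)
Lemma answer_missed l1 x m L : follow_inv l1 (G x) m L -> x \notin L ->
  answer (rcons l1 x) = answer l1.
Proof.
move=> [[_ inv] _ cmp] xL; rewrite /answer; congr (nat_of_bool (~~ _)).
apply/asbool_equiv_eq; split=> -[u]; last first.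
  by move=> ul cu; exists u; rewrite // mem_rcons inE ul orbT.
rewrite mem_rcons inE => /orP[/eqP->|ul] cu; last by exists u.
case: cu => a [y [a0 ay ryx]]; case/negP: xL.
apply: reach_closed ryx; first exact: (dfs_done inv).
by apply: cmp; right; apply/labelled_targetsP; exists a.
Qed.

Lemma follow_edge_spec m k x l d e r L :
  follow_inv l d m L -> G x = d ++ e :: r -> edges_at m (reg m 13) (e :: r) ->
  wp follow_edge m k (fun k' m' => exists L', [/\ follow_inv l (rcons d e) m' (L ++ L'),
    edges_at m' (reg m' 13) r,
    forall r, r \in [:: 0; 10; 12; 17] -> reg m' r = reg m r &
    k' + 20 * unseen G N (L ++ L') <= k + 39 + 20 * unseen G N L]).
Proof.
move=> [st snd cmp] Gx [p0 lbE tgE _ ch]; have z1 := state_zero st.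
case: e => a y /= in Gx lbE tgE *.
rewrite /follow_edge; wp_steps; rewrite /= lbE tgE.
wp_branch; rewrite /= z1.
  move=> /eqP a0; wp_steps; exists [::]; rewrite cats0; split=> //; last 2 first.
  - by move=> i; rewrite !inE => /or4P[] /eqP->.
  - by lia.
  split; first by apply: dfs_state_eq st; by_index.
    move=> v /snd[z zl zv]; exists z => //; case: zl; first by left.
    move=> /labelled_targetsP[b b0 bz]; right; apply/labelled_targetsP.
    by exists b; rewrite // mem_rcons inE bz orbT.
  by move=> z /exits_rcons[/cmp|[]] //; rewrite a0.
move=> a0; wp_steps; rewrite /=.
apply: dfs_call => [||k' m' L' st' yL rch [er ea] kB].
- by apply: dfs_state_eq st; by_index.
- by rewrite /=; apply: G_lt (@edge_mem _ a x _ _); rewrite Gx mem_cat mem_head orbT.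
exists L'; rewrite /= in yL rch kB; split; last by lia.
- split=> //.
    move=> v; rewrite mem_cat => /orP[/snd[z zl zv]|/rch yv].
      exists z => //; case: zl; first by left.
      move=> /labelled_targetsP[b b0 bz]; right; apply/labelled_targetsP.
      by exists b; rewrite // mem_rcons inE bz orbT.
    exists y => //; right; apply/labelled_targetsP; exists a => //.
    by rewrite mem_rcons mem_head.
  move=> z /exits_rcons[/cmp zL|[_ ->]] //; by rewrite mem_cat zL.
- by rewrite /edges_at !ea // er.
- by move=> i; rewrite !inE => /or4P[] /eqP->; rewrite er.
Qed.

Lemma find_cycles_spec m k :
  dfs_state 2 L1 m L2 -> reg m 0 = 1 -> reg m 10 = size L1 ->
  wp find_cycles m k (fun k' m' => reg m' 0 = answer L2 /\
    k' <= k + 6 + 20 * unseen G N [::] + 40 * weight G L2).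
Proof.
move=> st r0 r10; rewrite /find_cycles; wp_steps; rewrite /=.
have [B BE] : exists B, B = k + 6 + 20 * unseen G N [::] + 40 * weight G L2.
  by exists (k + 6 + 20 * unseen G N [::] + 40 * weight G L2).
rewrite -BE.
pose Inv k m := exists l1 l2 L : seq nat, [/\ L2 = l1 ++ l2,
  follow_inv l1 [::] m L,
  [/\ reg m 0 = answer l1, reg m 10 = size (L1 ++ l1) & reg m 17 = size (L1 ++ L2)] &
  k + 3 + 20 * unseen G N L + 40 * weight G l2 <= B].
apply: (@wp_while _ _ _ _ B Inv).
- by move=> k' m' [l1 [l2 [L [_ _ _ ?]]]]; lia.
- move=> {BE}k {st r0 r10}m [l1 [l2 [L [LE fi [r0 r10 r17] kB]]]].
  case: l2 => [|x l2] in LE kB *.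
    by rewrite /holds r10 r17 LE cats0 ltnn.
  move=> _; wp_steps; rewrite /=.
  have st := follow_state fi.
  rewrite r10 (@log_read _ _ _ _ (L1 ++ l1) x (l2 ++ L) st); last by rewrite LE -!catA.
  pose Inv2 k m := exists (d r : seq (nat * nat)) (L' : seq nat),
    [/\ follow_inv l1 d m (L ++ L'), G x = d ++ r, edges_at m (reg m 13) r,
    [/\ reg m 0 = answer l1, reg m 10 = (size (L1 ++ l1)).+1, reg m 12 = x &
        reg m 17 = size (L1 ++ L2)] &
    k + 5 + 20 * unseen G N (L ++ L') + 40 * (size r + weight G l2) + 2 <= B].
  apply: (@wp_while _ _ _ _ B Inv2).
  + by move=> k' m' [d [r [L' [_ _ _ _ ?]]]]; lia.
  + move=> k' m' [d [r [L' [fi' Gx ch [r0' r10' r12' r17'] kB']]]].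
    rewrite /holds (state_zero (follow_state fi')).
    case: r => [|e r] in Gx ch kB' *; first by rewrite ch.
    move=> _; apply: wp_mono (follow_edge_spec _ fi' Gx ch) _.
    move=> k2 m2 [La [fi2 ch2 er kB2]]; exists (rcons d e), r, (L' ++ La).
    rewrite catA cat_rcons (er 0) // (er 10) // (er 12) // (er 17) //.
    by split=> //; move: kB' => /=; lia.
  + move=> k' m' [d [r [L' [fi' Gx ch [r0' r10' r12' r17'] kB']]]].
    have st' := follow_state fi'.
    rewrite /holds (state_zero st'); case: r => [|e r] in Gx ch kB' *; last first.
      by case: ch => ->.
    move=> _; rewrite cats0 in Gx; rewrite -Gx in fi'.
    have [_ ph2 _ _ seen _ _ _] := st'.1.
    have next m2 : dfs_state 3 (L1 ++ L2) m2 (L ++ L') ->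
        follow_inv (rcons l1 x) [::] m2 (L ++ L').
      case: fi' => _ snd cmp st2; split=> //.
        by move=> v /snd[y yl yv]; exists y => //; apply: exits_step.
      by move=> y /exits_next; apply: cmp.
    wp_steps; wp_branch.
      rewrite /= r12' ph2 seen /= => xL; wp_steps.
      exists (rcons l1 x), l2, (L ++ L'); split.
      * by rewrite cat_rcons.
      * by apply: next; apply: dfs_state_eq st'; by_index.
      * by rewrite /= (answer_found LE fi' xL) -rcons_cat size_rcons.
      * by move: kB' => /=; lia.
    rewrite /= r12' ph2 seen /= => xL; wp_steps.
    exists (rcons l1 x), l2, (L ++ L'); split.
    * by rewrite cat_rcons.
    * by apply: next; apply: dfs_state_eq st'; by_index.
    * by rewrite /= (answer_missed fi' xL) -rcons_cat size_rcons.
    * by move: kB' => /=; lia.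
  + exists [::], (G x), [::]; rewrite cats0; split=> //.
    * by case: fi => _ snd cmp; split=> //; apply: dfs_state_eq st; by_index.
    * exact: state_graph st _.
    * by move: kB; rewrite weight_cons; lia.
- move=> {BE}k {st r0 r10}m [l1 [l2 [L [LE fi [r0 r10 r17] kB]]]].
  case: l2 => [|x l2] in LE kB *; last first.
    by rewrite /holds r10 r17 LE catA [size (_ ++ _ :: _)]size_cat /= addnS ltnS leq_addr.
  move=> _; rewrite cats0 in LE; rewrite LE; split=> //; lia.
- exists [::], L2, [::]; split=> //=.
  + split=> //; first by apply: dfs_state_next st => //; by_index.
    by move=> y [[]|].
  + rewrite cats0 (log_size st) r0; split=> //; rewrite /answer.
    by case: asboolP => // -[].
  + by rewrite BE; lia.
Qed.

End Cycles.

Definition phases : prog := find_reachable ;; find_conflicts ;; find_cycles.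

(** Per unit of total weight, the three phases pay 20 each for searching, and the two scans of the
    log pay 40 each: 140 altogether. *)
Lemma phases_spec m k E root :
  build_mem m E -> G =1 adj E -> reg m 0 = 1 -> reg m 11 = root -> root < N ->
  wp phases m k (fun k' m' => reg m' 0 = `[< ~ rejected G root >] /\
    k' <= k + 24 + 140 * unseen G N [::]).
Proof.
move=> [z1 sp lp _ _ gr cl] GE r0 r11 rN; rewrite /phases /find_reachable.
wp_steps; rewrite /= r11.
have inv0 : dfs_inv G N [::] [::] by split=> // L1 u L2; case: L1.
apply: (@dfs_call 1 [::] _ _ [::]); rewrite //= .
  split=> //; split=> //=.
  - by rewrite sp.
  - by rewrite lp.
  - by move=> x; rewrite cl.
  - by move=> x; rewrite cl.
  - by move=> x; rewrite GE; apply: gr.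
move=> k1 m1 L1 st1 rootL rch1 [er ea] kB1; rewrite /= in er ea.
have [_ inv1] := st1.
have L1_lt x : x \in L1 -> x < N by apply: (dfs_lt inv1).
have w1 : weight G L1 <= unseen G N [::].
  by apply: weight_le L1_lt; apply: (dfs_uniq inv1).
have r01 : reg m1 0 = 1 by rewrite er.
have own1 a : arr m1 10 a = 0 by rewrite ea // cl.
apply: wp_seq; apply: wp_mono (find_conflicts_spec L1_lt rch1 k1 st1 r01 own1) _.
move=> k2 m2 [L2 [st2 [r0' r10'] bd cov kB2]].
have [_ inv2] := st2.
have w2 : weight G L2 <= unseen G N [::].
  by apply: weight_le; [apply: (dfs_uniq inv2) | apply: (dfs_lt inv2)].
apply: wp_mono (find_cycles_spec inv2 k2 st2 r0' r10') _ => k3 m3 [r0'' kB3].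
split; last by lia.
rewrite r0'' /answer -asbool_neg; congr nat_of_bool.
(* Everything in [L2] is reached from a conflict, by [bd]; conversely [L2] contains all conflicting
   vertices, by [cov], and is closed under edges. *)
apply/asbool_equiv_eq; apply: not_iff_compat; split.
  by case=> u /bd[x [b [rx cf bu]]] cu; exists x, b, u.
case=> x [b [u [rx cf bu cu]]]; exists u => //.
apply: reach_closed bu; first exact: (dfs_done inv2).
apply: (cov x) cf; apply: reach_closed rx; last exact: rootL.
exact: (dfs_done inv1).
Qed.

End Phases.

(** * Detectability and live states *)

Section Detectability.
Variable S : automaton.

Definition live (x : state S) := exists u t y s s',
  [/\ run x s u, (u, t, y) \in trans S, label t != None & run y s' u].

Definition connected (x : state S) :=
  exists x0 s, x0 \in initial S /\ run x0 s x.

Definition violation :=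
  (exists x0 x1, [/\ x0 \in initial S, x1 \in initial S, x0 != x1 & live x0]) \/
  (exists x, connected x /\
    ((exists t y, [/\ (x, t, y) \in trans S, label t = None, y != x & live x]) \/
     (exists t t' y z, [/\ (x, t, y) \in trans S /\ (x, t', z) \in trans S,
        label t != None, label t = label t', y != z & live y]))).

Lemma run_cat x s y s' z : run x s y -> run y s' z -> run (S := S) x (s ++ s') z.
Proof. by elim: s x => [x -> //|t s IH x [u xu uy] yz]; exists u => //; apply: IH. Qed.

Lemma run_catP x s s' z : run (S := S) x (s ++ s') z ->
  exists2 y, run x s y & run y s' z.
Proof.
elim: s x => [x r|t s IH x [u xu /IH[y uy yz]]]; first by exists x.
by exists y => //; exists u.
Qed.

Lemma run1 x t y : (x, t, y) \in trans S -> run x [:: t] y.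
Proof. by exists y. Qed.

Definition infinite_run (x : nat -> state S) (t : nat -> event S) :=
  forall i, (x i, t i, x i.+1) \in trans S.

Definition infinitely_labelled (t : nat -> event S) :=
  forall n, exists2 m, n <= m & label (t m) != None.

Lemma infinite_run_run x t i j : infinite_run x t -> i <= j ->
  run (x i) [seq t l | l <- iota i (j - i)] (x j).
Proof.
move=> r ij; rewrite -{2}(subnKC ij); move: (j - i) => n {ij}; elim: n i => [|n IH] i.
  by rewrite addn0.
by exists (x i.+1) => //; rewrite addnS -addSn; apply: IH.
Qed.

Lemma infinite_run_shift n x t : infinite_run x t ->
  infinite_run (fun i => x (n + i)) (fun i => t (n + i)).
Proof. by move=> r i; rewrite addnS; apply: r. Qed.

(** By the pigeonhole principle two labelled events of the run leave the same state; the piece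
    between them is a labelled cycle. *)
Lemma infinite_run_live x t : infinite_run x t -> infinitely_labelled t ->
  live (x 0).
Proof.
move=> r lt.
have [f fP] : {f : nat -> nat & forall n, n <= f n /\ label (t (f n)) != None}.
  apply: (@choice _ _ (fun n m => n <= m /\ label (t m) != None)) => n.
  by have [m] := lt n; exists m.
(* [g] lists positions of labelled events in strictly increasing order. *)
pose g := fix g k := if k is k'.+1 then f (g k').+1 else f 0.
have g_lab k : label (t (g k)) != None.
  by case: k => [|k]; [have [] := fP 0 | have [] := fP (g k).+1].
have g_lt i j : i < j -> g i < g j.
  elim: j => // j IH; rewrite ltnS leq_eqVlt => /orP[/eqP->|/IH].
    by case: (fP (g j).+1).
  by move/ltn_trans; apply; case: (fP (g j).+1).
have [i [j [ij xE]]] : exists i j, i < j /\ x (g i) = x (g j).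
  apply: contrapT => H.
  have inj : injective (fun i : 'I_(#|state S|.+1) => x (g i)).
    move=> i j E; apply/val_inj; case: (ltngtP i j) => // lt_ij; case: H.
      by exists i, j.
    by exists j, i.
  by have := leq_card _ inj; rewrite card_ord ltnn.
exists (x (g i)), (t (g i)), (x (g i).+1).
exists [seq t l | l <- iota 0 (g i - 0)], [seq t l | l <- iota (g i).+1 (g j - (g i).+1)].
split=> //; first exact: infinite_run_run.
by rewrite xE; apply: infinite_run_run => //; apply: g_lt.
Qed.

Lemma infinite_run_cat x s y Y t : run x s y -> Y 0 = y -> infinite_run Y t ->
  infinitely_labelled t -> exists X t',
    [/\ X 0 = x, infinite_run X t', infinitely_labelled t' & mkseq t' (size s) = s].
Proof.
elim: s x => [x -> Y0 rY lt|a s IH x [z xz zy] Y0 rY lt]; first by exists Y, t.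
have [X [t' [X0 rX lt' tE]]] := IH _ zy Y0 rY lt.
exists (fun i => if i is j.+1 then X j else x), (fun i => if i is j.+1 then t' j else a).
split=> //.
- by case=> [|i]; [rewrite X0 | apply: rX].
- by move=> n; have [m nm lm] := lt' n; exists m.+1 => //; apply: leqW.
- by rewrite /mkseq /= (iotaDl 1 0) -map_comp -[in RHS]tE.
Qed.

Lemma periodic_run x t s : run x (t :: s) x -> label t != None ->
  exists X t', [/\ X 0 = x, infinite_run X t' & infinitely_labelled t'].
Proof.
move=> r lt.
have path_of : forall s x y, run (S := S) x s y -> exists X : nat -> state S,
    [/\ X 0 = x, X (size s) = y &
        forall i, i < size s -> (X i, nth t s i, X i.+1) \in trans S].
  elim=> [|a s' IH] u y /=; first by move=> ->; exists (fun=> y).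
  case=> z uz /IH[X [X0 Xs rX]].
  exists (fun i => if i is j.+1 then X j else u); split=> //.
  by case=> [|i] //=; [rewrite X0 | apply: rX].
have [X [X0 Xs rX]] := path_of _ _ _ r.
set n := size (t :: s) in Xs rX.
exists (fun i => X (i %% n)), (fun i => nth t (t :: s) (i %% n)); split.
- by rewrite mod0n.
- move=> i; have lt_in : i %% n < n by rewrite ltn_mod.
  (* At the end of a period the index wraps to 0, which is harmless since [X n] and [X 0] are both
     [x]. *)
  have -> : X (i.+1 %% n) = X (i %% n).+1.
    rewrite -addn1 -modnDml addn1; move: lt_in; rewrite leq_eqVlt.
    by case/orP=> [/eqP->|/modn_small->//]; rewrite modnn X0 Xs.
  exact: rX.
- by move=> i; exists (i * n); rewrite ?leq_pmulr // modnMl.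
Qed.

Lemma live_infinite_run x : live x ->
  exists X t, [/\ X 0 = x, infinite_run X t & infinitely_labelled t].
Proof.
case=> u [t [y [s [s' [xu ut lt yu]]]]].
have [|Y [t' [Y0 rY lt']]] := @periodic_run u t s' _ lt; first by exists y.
by have [X [t'' [? ? ? _]]] := infinite_run_cat xu Y0 rY lt'; exists X, t''.
Qed.

Lemma labelsS t n :
  labels (mkseq t n.+1) = labels (mkseq t n) ++ seq_of_opt (@label S (t n)).
Proof. by rewrite mkseqS -cats1 /labels pmap_cat /=; case: label. Qed.

Lemma labels_mono t m n : m <= n ->
  exists r, labels (mkseq t n) = labels (S := S) (mkseq t m) ++ r.
Proof.
move/subnKC <-; elim: (n - m) => [|k [r IH]]; first by exists [::]; rewrite addn0 cats0.
by eexists; rewrite addnS labelsS IH -catA.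
Qed.

Lemma labels_size_inj t m n :
  size (labels (mkseq t m)) = size (labels (S := S) (mkseq t n)) ->
  labels (mkseq t m) = labels (mkseq t n).
Proof.
wlog mn : m n / m <= n => [H|].
  by case: (leqP m n) => [/H//|/ltnW/H{}H] E; rewrite H.
have [[|a r] ->] := labels_mono t mn; rewrite ?cats0 // size_cat /=; lia.
Qed.

(** An event adds at most one letter, so the first prefix with at least [k] letters has exactly
    [k]. *)
Lemma labels_size_onto t k : infinitely_labelled t ->
  exists n, size (labels (mkseq t n)) = k.
Proof.
move=> lt; have unbounded : exists n, k <= size (labels (mkseq t n)).
  elim: k => [|k [n IH]]; first by exists 0.
  have [m nm lm] := lt n; exists m.+1; have [r E] := labels_mono t nm.
  by rewrite labelsS E !size_cat; case: (label _) lm => //= a _; lia.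
case: (ex_minnP unbounded) => -[|n] le min_n.
  by exists 0; move: le; rewrite leqn0 => /eqP->.
exists n.+1; have := min_n n; move: le; rewrite labelsS size_cat.
by case: (label _) => [a|] /=; lia.
Qed.

Lemma omega_word_exists t : infinitely_labelled t -> exists sigma, labels_omega t sigma.
Proof.
move=> lt; have [m0 _] := lt 0; case: (label (t m0)) => [d _|//].
have [N NP] : {N : nat -> nat & forall k, size (labels (mkseq t (N k))) = k}.
  apply: (@choice _ _ (fun k n => size (labels (mkseq t n)) = k)) => k.
  exact: labels_size_onto.
(* Letter [k] is read off a prefix with [k.+1] letters, so the default [d] is never returned; [d]
   itself is the label of some event of [t]. *)
exists (fun k => nth d (labels (mkseq t (N k.+1))) k) => k; exists (N k).
apply: (@eq_from_nth _ d); first by rewrite NP size_mkseq.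
move=> i; rewrite NP => ik; rewrite nth_mkseq //.
by case: (leqP (N k) (N i.+1)) => [|/ltnW] /(labels_mono t)[r ->];
  rewrite nth_cat NP ?ik ?ltnSn.
Qed.

(** If no event from [n] on were labelled, the label word would stop growing and miss the longer
    prefixes of [sigma]. *)
Lemma omega_infinitely_labelled t sigma :
  labels_omega (S := S) t sigma -> infinitely_labelled t.
Proof.
move=> om n; apply: contrapT => H.
have stuck j : labels (mkseq t (n + j)) = labels (mkseq t n).
  elim: j => [|j IH]; first by rewrite addn0.
  rewrite addnS labelsS IH; case E: (label (t (n + j))) => [a|]; last by rewrite cats0.
  by case: H; exists (n + j); rewrite ?leq_addr ?E.
have [n' E] := om (size (labels (mkseq t n))).+1.
have := size_mkseq sigma (size (labels (mkseq t n))).+1; rewrite -E.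
case: (leqP n n') => [/subnKC<-|/ltnW/(labels_mono t)[r ->]].
  by rewrite stuck; lia.
by rewrite size_cat; lia.
Qed.

(** Admitting the empty event sequence absorbs the special clause for the initial states. *)
Lemma mem_current sigma z : reflect
  (exists x0 s, [/\ x0 \in initial S, labels s = sigma & run x0 s z])
  (z \in current_states sigma).
Proof.
rewrite inE; apply: (iffP (asboolP _)) => [[[-> zI]|[x0 [s [xI _ <- r]]]]|].
- by exists z, [::].
- by exists x0, s.
case=> x0 [[|t s] [xI <- r]]; first by left; split=> //; rewrite -r.
by right; exists x0, (t :: s).
Qed.

(** Liveness of [y] extends the run to an infinite one with infinitely many labels, whose word in
    the omega-language has [labels s] as a prefix. *)
Lemma card_current_live x0 s y : instantly_strongly_detectable S ->
  x0 \in initial S -> run x0 s y -> live y -> #|current_states (labels s)| = 1.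
Proof.
move=> isd xI r /live_infinite_run[Y [t [Y0 rY lt]]].
have [X [t' [X0 rX lt' tE]]] := infinite_run_cat r Y0 rY lt.
have [sigma om] := omega_word_exists lt'.
have [n nE] := om (size (labels s)).
have E : mkseq sigma (size (labels s)) = labels s.
  rewrite -nE -[in RHS]tE; apply: labels_size_inj.
  by rewrite nE size_mkseq tE.
rewrite -E; apply: isd; exists t' => //; by exists X; rewrite ?X0.
Qed.

Lemma card1_eq (A : {set state S}) x y : #|A| = 1 -> x \in A -> y \in A -> x = y.
Proof. by move/eqP/cards1P => [z ->]; rewrite !inE => /eqP-> /eqP->. Qed.

(** Each kind of violation gives two distinct states reached on one and the same word, one of them
    live. *)
Lemma no_violation : instantly_strongly_detectable S -> ~ violation.
Proof.
move=> isd [[x0 [x1 [x0I x1I /eqP ne lv]]]|[x [[x0 [s [xI r]]]]]].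
  have c := card_current_live (s := [::]) isd x0I erefl lv.
  by case: ne; apply: (card1_eq c); apply/mem_current; [exists x0, [::] | exists x1, [::]].
case=> [[t [y [tr lt /eqP ne lv]]]|[t [t' [y [z [[tr tr'] lt tt' /eqP ne lv]]]]]].
  have c := card_current_live isd xI r lv.
  case: ne; apply: (card1_eq c); apply/mem_current; last by exists x0, s.
  exists x0, (s ++ [:: t]); split=> //; last by apply: run_cat r (run1 tr).
  by rewrite /labels pmap_cat /= lt cats0.
have ry := run_cat r (run1 tr); have c := card_current_live isd xI ry lv.
case: ne; apply: (card1_eq c); apply/mem_current; first by exists x0, (s ++ [:: t]).
exists x0, (s ++ [:: t']); split=> //; last by apply: run_cat r (run1 tr').
by rewrite /labels !pmap_cat /= tt'.
Qed.

Lemma labels_rcons_inv (s : seq (event S)) sigma a : labels s = rcons sigma a ->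
  exists s1 t s2, [/\ s = s1 ++ t :: s2, labels s1 = sigma, label t = Some a &
    labels s2 = [::]].
Proof.
elim/last_ind: s => [|s t IH]; first by case: sigma.
rewrite /labels -cats1 pmap_cat /=; case lt: (label t) => [b|] /=.
  by rewrite cats1 => /rcons_inj[sE ab]; exists s, t, [::]; rewrite lt ab.
rewrite cats0 => /IH[s1 [t' [s2 [-> ? ? s2E]]]].
exists s1, t', (rcons s2 t); split=> //; first by rewrite -catA cats1.
by rewrite /labels -cats1 pmap_cat /= lt cats0.
Qed.

(** Without violations, the silent transitions of a reachable live state are loops. *)
Lemma silent_run x s y : ~ violation -> connected x -> live x -> run x s y ->
  labels s = [::] -> y = x.
Proof.
move=> nv cx lx; elim: s => [->//|t s IH] [z tr r] /=.
case lt: (label t) => //= sE; have [zx|zx] := eqVneq z x.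
  by apply: IH sE; rewrite -{1}zx.
by case: nv; right; exists x; split=> //; left; exists t, z.
Qed.

(** For the converse, all states [X i] of an infinite run are live and reachable. Induction on [n]
    shows that [X n] is the only state compatible with the first [n] events, any deviation being a
    violation. *)
Lemma detectable_violation : instantly_strongly_detectable S <-> ~ violation.
Proof.
split; first exact: no_violation.
move=> nv sigma [t [X X0 rX] om] k; have [n <-] := om k.
have lt := omega_infinitely_labelled om.
have lv i : live (X i).
  have := infinite_run_live (infinite_run_shift i rX); rewrite addn0; apply.
  move=> j; have [m ijm lm] := lt (i + j); exists (m - i); first lia.
  by rewrite subnKC //; lia.
have rn i : run (X 0) (mkseq t i) (X i).
  by have := infinite_run_run rX (leq0n i); rewrite subn0.
have cn i : connected (X i) by exists (X 0), (mkseq t i).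
suff -> : current_states (labels (mkseq t n)) = [set X n] by rewrite cards1.
apply/setP => z; rewrite inE; apply/mem_current/eqP => [|->]; last first.
  by exists (X 0), (mkseq t n).
elim: n z => [|n IH] z [x0 [s [xI sE r]]].
  have x0E : x0 = X 0.
    have [//|ne] := eqVneq x0 (X 0); case: nv; left; exists (X 0), x0.
    by split; rewrite // eq_sym.
  by rewrite x0E in r; apply: silent_run r sE.
move: sE; rewrite labelsS; case ltn: (label (t n)) => [a|] /=; last first.
  rewrite cats0 => sE; have [XE|XE] := eqVneq (X n.+1) (X n).
    by rewrite XE; apply: IH; exists x0, s.
  by case: nv; right; exists (X n); split=> //; left; exists (t n), (X n.+1).
(* The competing run is cut at its last labelled event: before it the induction hypothesis applies,
   after it only silent loops remain. *)
rewrite cats1 => /labels_rcons_inv[s1 [t' [s2 [sE s1E t'E s2E]]]].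
move: r; rewrite sE => /run_catP[w r1 [y tr r2]].
have wE : w = X n by apply: IH; exists x0, s1.
rewrite wE in tr; suff yE : y = X n.+1.
  by rewrite yE in r2; apply: silent_run r2 s2E.
have [//|ne] := eqVneq y (X n.+1); case: nv; right; exists (X n); split=> //; right.
by exists (t n), t', (X n.+1), y; split; rewrite ?ltn ?t'E // eq_sym.
Qed.

End Detectability.

(** * The graph of an automaton *)

Lemma mem_adj E x a y : ((a, y) \in adj E x) = ((x, a, y) \in E).
Proof.
apply/mapP/idP => [[[[x' a'] y'] /=]|xay].
  by rewrite mem_filter /= => /andP[/eqP-> ?] [-> ->].
by exists (x, a, y); rewrite // mem_filter eqxx.
Qed.

Lemma weight_adj_cons e E l :
  weight (adj (e :: E)) l = count_mem e.1.1 l + weight (adj E) l.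
Proof.
elim: l => [|x l IH]; first by rewrite /weight !big_nil.
by rewrite !weight_cons IH /adj /= [x == _]eq_sym; case: (_ == x) => /=; lia.
Qed.

Lemma weight_adj (E : edge_list) (l : seq nat) : uniq l -> weight (adj E) l <= size l + size E.
Proof.
move=> ul; elim: E => [|e E IH]; first by rewrite /weight sum1_size addn0.
by rewrite weight_adj_cons count_uniq_mem //=; case: (_ \in _); lia.
Qed.

Section Encoding.
Variables (S : automaton) (I : seq (state S)) (D : seq (state S * event S * state S)).
Hypothesis I_enum : perm_eq I (enum (initial S)).
Hypothesis D_enum : perm_eq D (enum (trans S)).

Definition rank (T : finType) (x : T) : nat := enum_rank x.

Lemma rank_inj T : injective (@rank T).
Proof. by move=> x y /val_inj /enum_rank_inj. Qed.

Lemma rank_lt (T : finType) (x : T) : rank x < #|T|. Proof. exact: ltn_ord. Qed.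

Definition initial_codes := [seq rank x | x <- I].
Definition label_codes := [seq label_code (@label S t) | t <- enum (event S)].
Definition trans_codes : edge_list := [seq (rank d.1.1, rank d.1.2, rank d.2) | d <- D].

Lemma label_codes_rank (t : event S) : nth 0 label_codes (rank t) = label_code (label t).
Proof.
by rewrite (nth_map t) ?nth_enum_rank // -cardE; apply: rank_lt.
Qed.

Definition coded_edges :=
  edges_of #|state S| #|output S| initial_codes label_codes trans_codes.

Definition coded_graph := adj coded_edges.
Notation G := coded_graph.
Notation root := #|state S|.

Lemma mem_coded x a y : (a, y) \in G x <->
  (exists u t v, [/\ (u, t, v) \in trans S, x = rank u,
     a = label_code (label t) & y = rank v]) \/
  (x = root /\ a = #|output S|.+1 /\ exists2 v, v \in initial S & y = rank v).
Proof.
rewrite mem_adj mem_cat !mem_rev -!map_comp; split.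
  case/orP=> /mapP[].
    move=> [[u t] v]; rewrite (perm_mem D_enum) mem_enum => tr /=.
    by rewrite label_codes_rank => -[-> -> ->]; left; exists u, t, v.
  move=> v; rewrite (perm_mem I_enum) mem_enum => vI [-> -> ->].
  by right; split=> //; split=> //; exists v.
case=> [[u [t [v [tr -> -> ->]]]]|[-> [-> [v vI ->]]]]; apply/orP.
  left; apply/mapP; exists (u, t, v); first by rewrite (perm_mem D_enum) mem_enum.
  by rewrite /= label_codes_rank.
by right; apply/mapP; exists v => //; rewrite (perm_mem I_enum) mem_enum.
Qed.

Lemma coded_state x a y : (a, y) \in G (rank x) <->
  exists t v, [/\ (x, t, v) \in trans S, a = label_code (label t) & y = rank v].
Proof.
rewrite mem_coded; split=> [[[u [t [v [tr /rank_inj-> -> ->]]]]|[E]]|[t [v [tr -> ->]]]].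
- by exists t, v.
- by have := rank_lt x; rewrite E ltnn.
- by left; exists x, t, v.
Qed.

Lemma coded_root a y : (a, y) \in G root <->
  a = #|output S|.+1 /\ exists2 v, v \in initial S & y = rank v.
Proof.
rewrite mem_coded; split=> [[[u [t [v [_ E]]]]|[]//]|]; last by right.
by have := rank_lt u; rewrite -E ltnn.
Qed.

Lemma edgeP x y : edge G x y <-> exists a, (a, y) \in G x.
Proof.
split=> [/mapP[[a z] az ->]|[a]]; [by exists a | exact: edge_mem].
Qed.

Lemma coded_lt x y : edge G x y -> y < root.+1.
Proof.
case/edgeP=> a /mem_coded[[u [t [v [_ _ _ ->]]]]|[_ [_ [v _ ->]]]];
  by rewrite ltnW // ltnS rank_lt.
Qed.

Lemma reach_coded (x : state S) y : reach G (rank x) y <-> exists v s, y = rank v /\ run x s v.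
Proof.
split=> [[p]|[v [s [-> {y}]]]].
  elim: p x => [|z p IH] x /=; first by move=> _ <-; exists x, [::].
  case/andP=> /edgeP[a /coded_state[t [u [tr _ ->]]]] pp /(IH _ pp)[v [s [-> r]]].
  by exists v, (t :: s); split=> //; exists u.
elim: s x => [x ->|t s IH x [z tr r]]; first exact: reach_refl.
apply: reach_trans (IH _ r); apply: reach_edge; apply/edgeP.
by exists (label_code (label t)); apply/coded_state; exists t, z.
Qed.

Lemma reach_root y : reach G root y <->
  y = root \/ exists x : state S, connected x /\ y = rank x.
Proof.
split=> [[[|z p] /=]|[->|[x [[x0 [s [xI r]]] ->]]]].
- by move=> _ <-; left.
- case/andP=> /edgeP[a /coded_root[_ [x xI ->]]] pp lE; right.
  have /reach_coded[v [s [-> r]]] : reach G (rank x) y by exists p.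
  by exists v; split=> //; exists x, s.
- exact: reach_refl.
apply: (@reach_trans _ _ (rank x0)); last by apply/reach_coded; exists x, s.
apply: reach_edge; apply/edgeP; exists #|output S|.+1; apply/coded_root.
by split=> //; exists x0.
Qed.

Lemma label_code0 (t : event S) : label_code (label t) = 0 <-> label t = None.
Proof. by case: (label t). Qed.

Lemma label_code_inj : injective (@label_code S).
Proof. by case=> [a|] [b|] //= [/val_inj/enum_rank_inj->]. Qed.

Lemma live_coded (x : state S) : live x <->
  exists2 u, reach G (rank x) u & on_labelled_cycle G u.
Proof.
split=> [[u [t [y [s [s' [xu tr lt yu]]]]]]|[u /reach_coded[v [s [-> xv]]]]].
  exists (rank u); first by apply/reach_coded; exists u, s.
  exists (label_code (label t)), (rank y); split.
  - by apply/eqP => /label_code0 E; rewrite E in lt.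
  - by apply/coded_state; exists t, y.
  - by apply/reach_coded; exists u, s'.
case=> a [y [a0 /coded_state[t [z [tr aE ->]]] /reach_coded[v' [s' [/rank_inj<- r]]]]].
exists v, t, z, s, s'; split=> //; apply/eqP => /label_code0.
by rewrite -aE; apply/eqP.
Qed.

(** All edges of the root carry the same nonzero label, so its conflicts are the pairs of distinct
    initial states; at the other reachable vertices, conflicts correspond to the second kind of
    violation. *)
Lemma rejected_violation : rejected G root <-> violation S.
Proof.
split.
  move=> [x [b [u [/reach_root rx cf bu cu]]]].
  have lv (v : state S) : b = rank v -> live v.
    by move=> bE; apply/live_coded; exists u; rewrite -?bE.
  case: rx => [xE|[v [cv xE]]]; subst x.
    left; case: cf => [[_ [y /coded_root[]]]//|[a [y [_ ]]]].
    move=> /coded_root[_ [b' bI bE]] /coded_root[_ [y' yI ->]].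
    rewrite bE => yb; exists b', y'; split=> //; last exact: lv.
    by apply: contraNneq yb => ->.
  right; exists v; split=> //; case: cf => [[bE [y /coded_state[t [z [tr l0 ->]]] zv]]|].
    left; exists t, z; split=> //; last exact: lv.
      by apply/label_code0.
    by apply: contraNneq zv => ->.
  case=> a [y [a0 /coded_state[t [b' [tr lt bE]]] /coded_state[t' [y' [tr' lt' ->]]]]].
  rewrite bE => yb; right; exists t, t', b', y'; split=> //; last exact: lv.
  - by apply/eqP => /label_code0; rewrite -lt; apply/eqP.
  - by apply: label_code_inj; rewrite -lt -lt'.
  - by apply: contraNneq yb => ->.
have rej x b (v : state S) : reach G root x -> conflict G x b -> b = rank v -> live v ->
    rejected G root.
  by move=> rx cf bE /live_coded[u bu cu]; exists x, b, u; split=> //; rewrite bE.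
case=> [[x0 [x1 [x0I x1I ne lv]]]|[x [cx]]].
  apply: rej lv => //; first exact: reach_refl.
  right; exists #|output S|.+1, (rank x1); split=> //.
  - by apply/coded_root; split=> //; exists x0.
  - by apply/coded_root; split=> //; exists x1.
  - by rewrite (inj_eq (@rank_inj _)) eq_sym.
have rx : reach G root (rank x) by apply/reach_root; right; exists x.
case=> [[t [y [tr lt yx lv]]]|[t [t' [y [z [[tr tr'] lt tt' yz lv]]]]]].
  apply: rej lv => //; first exact: rx.
  left; split=> //; exists (rank y); last by rewrite (inj_eq (@rank_inj _)).
  by apply/coded_state; exists t, y; rewrite lt.
apply: rej lv => //; first exact: rx.
right; exists (label_code (label t)), (rank z); split.
- by apply/eqP => /label_code0 E; rewrite E in lt.
- by apply/coded_state; exists t, y.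
- by apply/coded_state; exists t', z; rewrite tt'.
- by rewrite (inj_eq (@rank_inj _)) eq_sym.
Qed.

Lemma coded_weight : unseen G root.+1 [::] <=
  root.+1 + (size trans_codes + size initial_codes).
Proof.
apply: leq_trans (weight_adj _ _) _; first by rewrite filter_uniq ?iota_uniq.
apply: leq_add; first by rewrite size_filter (leq_trans (count_size _ _)) ?size_iota.
by rewrite /coded_edges /edges_of size_cat !size_rev !size_map.
Qed.

End Encoding.

Theorem theorem3 :
  exists (p : prog) (c : nat),
    forall (S : automaton) (w : seq nat), encodes S w ->
      answers_within p w (instantly_strongly_detectable S)
        (c * (automaton_size S).+1).
Proof.
(* Construction and searches together have constant cost at most 204 and coefficient at most 160 for
   each component of the size; 300 is a generous bound for both. *)
exists (Seq build phases), 300 => S w [I [D [Ie De wE]]].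
have {}wE : w = word_of #|state S| #|event S| #|output S|
    (initial_codes I) (label_codes S) (trans_codes D).
  rewrite wE /word_of !size_map; congr (_ ++ (_ ++ (_ ++ flatten _))).
  by rewrite -map_comp; apply: eq_map => -[[x t] y].
have sI : size I = #|initial S| by rewrite (perm_size Ie) cardE.
have sD : size D = #|trans S| by rewrite (perm_size De) cardE.
have sw : size (label_codes S) = #|event S| by rewrite size_map cardE.
have Dlt d : d \in trans_codes D -> d.1.2 < #|event S|.
  by case/mapP => d' _ ->; apply: rank_lt.
set B := 40 + 20 * (size I + #|event S| + size D).
have kB : 40 + 20 * (size (initial_codes I) + #|event S| + size (trans_codes D)) <= B.
  by rewrite !size_map.
have [k [m [ex [r0 kb]]]] : wp (Seq build phases) (input_memory w) 0 (fun k m =>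
    reg m 0 = `[< ~ rejected (coded_graph I D) #|state S| >] /\
    k <= B + 24 + 140 * unseen (coded_graph I D) #|state S|.+1 [::]).
  rewrite wE; apply: wp_seq; apply: build_spec sw Dlt kB _ => k m kB bm r0 r11.
  apply: wp_mono (phases_spec (coded_lt Ie De) k bm _ r0 r11 _) _ => // k' m' [-> k'B].
  by split=> //; lia.
exists k, m; split=> //.
  have := coded_weight I D; rewrite !size_map /automaton_size /B in kb *; lia.
rewrite r0; congr nat_of_bool; apply/asbool_equiv_eq.
rewrite detectable_violation; apply: not_iff_compat; exact: rejected_violation.
Qed.
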